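(* Let $X$ be an irreducible affine variety over $\mathbb{C}$ of dimension $n$, and $\mathcal{F}$ an algebraic foliation on $X$. Let $p=\max_{x\in X}\dim V(\mathcal{F},x)$. Then there exists a dominant rational map $F:X\dashrightarrow Y$, where $Y$ is an irreducible variety of dimension $n-p$, such that for every very generic point $x$ of $X$, the Zariski closure of $F^{-1}(F(x))$ equals $V(\mathcal{F},x)$. In particular, the transcendence degree over $\mathbb{C}$ of the field $K_{\mathcal{F}}$ is $n-p$.
   Context: $\mathcal{O}_X$ denotes the ring of regular functions on $X$. An algebraic foliation $\mathcal{F}$ on $X$ is a collection of algebraic vector fields on $X$, viewed as $\mathbb{C}$-derivations of $\mathcal{O}_X$, which is stable under Lie bracket. For a Zariski closed subset $Y\subseteq X$ with vanishing ideal $I_Y$, $I(\mathcal{F},Y)$ denotes the largest ideal $I$ of $\mathcal{O}_X$ with $I\subseteq I_Y$ and $\partial(I)\subseteq I$ for all $\partial\in\mathcal{F}$; $V(\mathcal{F},Y)$ is its zero set, and $V(\mathcal{F},x):=V(\mathcal{F},\{x\})$. A rational first integral of $\mathcal{F}$ is a non-constant rational function $f$ on $X$ with $\partial(f)=0$ for all $\partial\in\mathcal{F}$; $K_{\mathcal{F}}$ is the field generated by $\mathbb{C}$ and the rational first integrals of $\mathcal{F}$. A property holds for every very generic point of $X$ if it holds at every point of some countable intersection of nonempty Zariski-open subsets of $X$. *)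

(* Defs.v *)
From HB Require Import structures.
From mathcomp Require Import all_boot all_algebra.
From mathcomp Require Import reals.
From mathcomp Require Import complex.
From mathcomp Require Import mpoly.

Set Implicit Arguments.
Unset Strict Implicit.
Unset Printing Implicit Defensive.

Import GRing.Theory Num.Theory.
Local Open Scope ring_scope.

Section AffineGeometry.
Variable K : fieldType.

Definition point (N : nat) := 'I_N -> K.

Definition incl (T : Type) (A B : T -> Prop) := forall x, A x -> B x.

Definition zero_set (N : nat) (S : {mpoly K[N]} -> Prop) : point N -> Prop :=
  fun z => forall f, S f -> f.@[z] = 0.

Definition vanishing_ideal (N : nat) (Z : point N -> Prop) : {mpoly K[N]} -> Prop :=
  fun f => forall z, Z z -> f.@[z] = 0.

Definition zariski_closed (N : nat) (Z : point N -> Prop) :=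
  exists S : {mpoly K[N]} -> Prop, forall z, Z z <-> zero_set S z.

Definition zariski_closure (N : nat) (S : point N -> Prop) : point N -> Prop :=
  zero_set (vanishing_ideal S).

Definition irreducible_closed (N : nat) (Z : point N -> Prop) :=
  [/\ zariski_closed Z, exists z, Z z &
      forall Z1 Z2 : point N -> Prop, zariski_closed Z1 -> zariski_closed Z2 ->
        incl Z (fun z => Z1 z \/ Z2 z) -> incl Z Z1 \/ incl Z Z2].

Definition has_chain (N : nat) (Z : point N -> Prop) (k : nat) :=
  exists C : nat -> point N -> Prop,
    [/\ forall i, (i <= k)%N -> irreducible_closed (C i),
        forall i, (i < k)%N -> incl (C i) (C i.+1) /\ ~ incl (C i.+1) (C i)
      & incl (C k) Z].

Definition dim_eq (N : nat) (Z : point N -> Prop) (d : nat) :=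
  has_chain Z d /\ ~ has_chain Z d.+1.

Definition is_ideal (N : nat) (J : {mpoly K[N]} -> Prop) :=
  [/\ J 0, forall f g, J f -> J g -> J (f + g) & forall f g, J g -> J (f * g)].

Definition is_derivation (N : nat) (D : {mpoly K[N]} -> {mpoly K[N]}) :=
  [/\ forall f g, D (f + g) = D f + D g,
      forall (c : K) f, D (c *: f) = c *: D f
    & forall f g, D (f * g) = f * D g + D f * g].

(* An algebraic vector field on the affine variety X (a derivation of         *)
(* O_X = K[x]/I_X) is represented by a lift: a derivation of K[x] mapping     *)
(* I_X into I_X.  Two lifts represent the same vector field iff they agree    *)
(* modulo I_X.                                                                *)
Definition vector_field_on (N : nat) (X : point N -> Prop)
    (D : {mpoly K[N]} -> {mpoly K[N]}) :=
  is_derivation D /\ forall f, vanishing_ideal X f -> vanishing_ideal X (D f).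

Definition foliation (N : nat) (X : point N -> Prop)
    (F : ({mpoly K[N]} -> {mpoly K[N]}) -> Prop) :=
  (forall D, F D -> vector_field_on X D) /\
  forall D1 D2, F D1 -> F D2 -> exists D3, F D3 /\
    forall f, vanishing_ideal X (D1 (D2 f) - D2 (D1 f) - D3 f).

(* I(F,Y): the largest F-stable ideal of O_X contained in I_Y, i.e. (lifted to *)
(* K[x]) the union of all F-stable ideals J with I_X <= J <= I_Y.             *)
Definition foliation_ideal (N : nat) (X : point N -> Prop)
    (F : ({mpoly K[N]} -> {mpoly K[N]}) -> Prop) (Y : point N -> Prop) :
    {mpoly K[N]} -> Prop :=
  fun f => exists J : {mpoly K[N]} -> Prop,
    [/\ is_ideal J, incl (vanishing_ideal X) J, incl J (vanishing_ideal Y),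
        forall D, F D -> forall g, J g -> J (D g) & J f].

Definition Vfol (N : nat) (X : point N -> Prop)
    (F : ({mpoly K[N]} -> {mpoly K[N]}) -> Prop) (Y : point N -> Prop) :=
  zero_set (foliation_ideal X F Y).

Definition Vfol_pt (N : nat) (X : point N -> Prop)
    (F : ({mpoly K[N]} -> {mpoly K[N]}) -> Prop) (x : point N) :=
  Vfol X F (fun z => z = x).

Definition rational_function (N : nat) (X : point N -> Prop) (a b : {mpoly K[N]}) :=
  ~ vanishing_ideal X b.

Definition ratval (N : nat) (X : point N -> Prop) (a b : {mpoly K[N]})
    (z : point N) (w : K) :=
  exists c d : {mpoly K[N]},
    [/\ d.@[z] != 0, vanishing_ideal X (c * b - a * d) & w = c.@[z] / d.@[z]].

Definition ratmap_val (N M : nat) (X : point N -> Prop)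
    (a b : 'I_M -> {mpoly K[N]}) (z : point N) (y : point M) :=
  X z /\ forall j, ratval X (a j) (b j) z (y j).

Definition ratmap_fiber (N M : nat) (X : point N -> Prop)
    (a b : 'I_M -> {mpoly K[N]}) (x : point N) : point N -> Prop :=
  fun z => exists y, ratmap_val X a b x y /\ ratmap_val X a b z y.

Definition ratmap_image (N M : nat) (X : point N -> Prop)
    (a b : 'I_M -> {mpoly K[N]}) : point M -> Prop :=
  fun y => exists z, ratmap_val X a b z y.

Definition very_generic (N : nat) (X : point N -> Prop) (P : point N -> Prop) :=
  exists Z : nat -> point N -> Prop,
    (forall k, zariski_closed (Z k) /\ ~ incl X (Z k)) /\
    forall x, X x -> (forall k, ~ Z k x) -> P x.

(* a/b is a rational first integral of F: nonconstant and killed by every    *)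
(* D in F; D(a/b) = (D a * b - a * D b)/b^2 vanishes in K(X)                 *)
Definition first_integral (N : nat) (X : point N -> Prop)
    (F : ({mpoly K[N]} -> {mpoly K[N]}) -> Prop) (a b : {mpoly K[N]}) :=
  [/\ rational_function X a b,
      forall D, F D -> vanishing_ideal X (D a * b - a * D b)
    & ~ exists c : K, vanishing_ideal X (a - c%:MP * b)].

Definition eval_at (N m : nat) (P : {mpoly K[m]}) (ga gb : 'I_m -> {mpoly K[N]})
    (z : point N) : K :=
  P.@[fun i => (ga i).@[z] / (gb i).@[z]].

(* a/b belongs to K_F, the subfield of K(X) generated by K and the rational  *)
(* first integrals: a/b = P(f)/Q(f) with f_i first integrals, Q(f) <> 0.     *)
(* (Two rational functions on the irreducible X are equal iff they agree on  *)
(* the dense open set where everything is defined.)                          *)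
Definition in_KF (N : nat) (X : point N -> Prop)
    (F : ({mpoly K[N]} -> {mpoly K[N]}) -> Prop) (a b : {mpoly K[N]}) :=
  rational_function X a b /\
  exists (m : nat) (fa fb : 'I_m -> {mpoly K[N]}) (P Q : {mpoly K[m]}),
    [/\ forall i, first_integral X F (fa i) (fb i),
        exists z, [/\ X z, forall i, (fb i).@[z] != 0 & eval_at Q fa fb z != 0]
      & forall z, X z -> b.@[z] != 0 -> (forall i, (fb i).@[z] != 0) ->
          eval_at Q fa fb z != 0 ->
          a.@[z] / b.@[z] = eval_at P fa fb z / eval_at Q fa fb z].

Definition alg_indep (N k : nat) (X : point N -> Prop) (ga gb : 'I_k -> {mpoly K[N]}) :=
  forall H : {mpoly K[k]}, H != 0 ->
    exists z, [/\ X z, forall i, (gb i).@[z] != 0 & eval_at H ga gb z != 0].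

Definition trdeg_KF_eq (N : nat) (X : point N -> Prop)
    (F : ({mpoly K[N]} -> {mpoly K[N]}) -> Prop) (d : nat) :=
  (exists ga gb : 'I_d -> {mpoly K[N]},
      (forall i, in_KF X F (ga i) (gb i)) /\ alg_indep X ga gb) /\
  ~ (exists ga gb : 'I_d.+1 -> {mpoly K[N]},
      (forall i, in_KF X F (ga i) (gb i)) /\ alg_indep X ga gb).

End AffineGeometry.

(* Main.v *)
(* Let E be the function field of X and L its subfield of elements killed by F.
   For x in X the ideal I(F,x) consists of the f such that every iterated
   derivative of f along F vanishes at x.  In bounded degree this is the kernel of
   a matrix with regular entries; over E that kernel is stable under the
   derivations extending F, hence spanned by vectors with entries in L, and these
   specialize to a basis of the kernel at x for x in a dense open set.  So at a
   very generic x the ideal I(F,x) is obtained by evaluating at x the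
   coefficients in L of the relations over L between the coordinates.  By
   Hilbert's basis theorem finitely many elements of L suffice, and they are the
   components of the rational map.

   The rank of the matrices can only drop at special points, so p is the
   transcendence degree of E over L, and additivity of transcendence degrees gives
   n - p for L.  Dimensions are related to transcendence degrees, and very generic
   points are produced, by one argument: C being uncountable, among uncountably
   many polynomials some infinite family has bounded degree, hence is linearly
   dependent. *)

(* No single open set of points suffices: membership in I(F,x) involves infinitely many words and
   polynomials of every degree. In one degree finitely many words carry all the conditions, which
   gives one nonempty open set; the intersection over all degrees is where very generic points come
   from.

   Equality of fibre and leaf has an easy half: if [a / b] lies in L and [b] does not vanish at x,
   then [a - c b], with c the value of [a / b] at x, belongs to I(F,x), so the leaf stays in the
   fibre wherever the denominators do not vanish. The poles are harmless because a factor that does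
   not vanish at x can be cancelled from a member of I(F,x).

   The components of the map come from two finite lists: constants whose values determine the leaf,
   and constants over which the leaf coordinates already make E algebraic. The second list gives the
   target its dimension n - p, by Steinitz exchange. *)
From HB Require Import structures.
From mathcomp Require Import all_boot all_order all_algebra.
From mathcomp Require Import boolp.
From mathcomp Require classical_sets.
From mathcomp Require Import reals complex mpoly.
From mathcomp Require Import ring.
Require Import Defs.

Set Implicit Arguments.
Unset Strict Implicit.
Unset Printing Implicit Defensive.

Import Order.TTheory GRing.Theory Num.Theory.
Local Open Scope ring_scope.

(** * Uncountable fields *)

(* The field is not a countable union of finite sets. *)
Definition uncountable (K : eqType) := forall tag : K -> nat,
  exists t, forall n, exists s : seq K,
    [/\ uniq s, size s = n & forall c, c \in s -> tag c = t].

Section Reals.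
Variables (R : realType) (f : nat -> R).

(** Cantor's nested intervals. The right end [(a + m) / 2], strictly below [m], keeps [f n'] outside
    the closed interval even when it equals [m]. *)
Fixpoint nested n : R * R :=
  if n is n'.+1 then
    let: (a, b) := nested n' in let m := (a + b) / 2 in
    if f n' < m then (m, b) else (a, (a + m) / 2)
  else (0, 1).

Lemma nested_lt n : (nested n).1 < (nested n).2.
Proof.
elim: n => [|n] /=; first exact: ltr01.
case: (nested n) => a b /= ab; case: ifP => _ /=; first by rewrite midf_lt.
by rewrite midf_lt // midf_lt.
Qed.

Lemma nested_mono n k :
  (nested n).1 <= (nested (n + k)).1 /\ (nested (n + k)).2 <= (nested n).2.
Proof.
elim: k => [|k [h1 h2]]; first by rewrite addn0.
have ab := nested_lt (n + k); rewrite addnS /=.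
case: (nested (n + k)) ab h1 h2 => a b /= ab h1 h2.
have := @midf_lt _ a b ab; case: ifP => _ /= [am mb].
  by rewrite (le_trans h1 (ltW am)).
rewrite h1; split=> //; have [_ h] := @midf_lt _ _ _ am.
by rewrite (le_trans (ltW (lt_trans h mb))).
Qed.

Lemma nested_le n k : (nested n).1 <= (nested k).2.
Proof.
have [h _] := nested_mono n k; have [_ h'] := nested_mono k n.
apply: le_trans h _; rewrite addnC; apply: le_trans h'; exact/ltW/nested_lt.
Qed.

Lemma real_sequence_misses : exists x, forall n, f n != x.
Proof.
pose A : R -> Prop := fun x => exists n, x = (nested n).1.
pose x := sup A; exists x => n.
have ub k : classical_sets.ubound A (nested k).2 by move=> _ [m ->]; exact: nested_le.
have hs : classical_sets.has_sup A by split; [exists (nested 0).1, 0%N|exists (nested 0).2].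
have x1 k : (nested k).1 <= x by apply: sup_upper_bound => //; exists k.
have x2 k : x <= (nested k).2 by apply: ge_sup => //; exists (nested 0).1, 0%N.
have := x1 n.+1; have := x2 n.+1; have := nested_lt n => /=.
case: (nested n) => a b /= ab; case: ifP => fm /=.
  by move=> _ mx; rewrite lt_eqF // (lt_le_trans fm).
move=> xm _; rewrite gt_eqF //; apply: (le_lt_trans xm).
have [am _] := @midf_lt _ _ _ ab; have [_ h] := @midf_lt _ _ _ am.
by apply: (lt_le_trans h); rewrite leNgt fm.
Qed.

End Reals.

(** Otherwise every class of [tag] is finite, and pairs of a tag and a position in its class
    enumerate the complex numbers; their real parts would exhaust the reals. *)
Lemma complex_uncountable (R : realType) : uncountable R[i].
Proof.
move=> tag; apply: contrapT => hn.
have fin t : exists s : seq R[i], forall c, tag c = t -> c \in s.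
  apply: contrapT => nofin; apply: hn; exists t; elim=> [|n [s [us ss st]]].
    by exists [::].
  have [c [tc cs]] : exists c, tag c = t /\ c \notin s.
    apply: contrapT => nc; apply: nofin; exists s => c tc.
    by apply/negPn/negP => cs; apply: nc; exists c.
  exists (c :: s); split; rewrite /= ?cs ?ss // => d.
  by rewrite inE => /orP[/eqP->|/st].
have [s hs] := choice fin.
pose f n := if unpickle n is Some (t, i) then complex.Re (nth 0 (s t) i) else 0.
have [x hx] := real_sequence_misses f.
have xs := hs _ _ (erefl (tag x%:C%C)).
have := hx (pickle (tag x%:C%C, index x%:C%C (s (tag x%:C%C)))).
by rewrite /f pickleK nth_index // eqxx.
Qed.

(** * Ideals of polynomial rings *)

Section Ideals.
Variables (K : fieldType) (N : nat).
Implicit Types (J : {mpoly K[N]} -> Prop) (f g h : {mpoly K[N]}).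

Lemma ideal0 J : is_ideal J -> J 0. Proof. by case. Qed.
Lemma idealD J f g : is_ideal J -> J f -> J g -> J (f + g).
Proof. by case=> _ h _; apply: h. Qed.
Lemma idealM J f g : is_ideal J -> J g -> J (f * g).
Proof. by case=> _ _; apply. Qed.
Lemma idealMr J f g : is_ideal J -> J f -> J (f * g).
Proof. by move=> *; rewrite mulrC; apply: idealM. Qed.
Lemma idealN J f : is_ideal J -> J f -> J (- f).
Proof. by move=> iJ Jf; rewrite -mulN1r; apply: idealM. Qed.
Lemma idealB J f g : is_ideal J -> J f -> J g -> J (f - g).
Proof. by move=> iJ Jf Jg; apply: idealD => //; apply: idealN. Qed.
Lemma idealZ J c f : is_ideal J -> J f -> J (c *: f).
Proof. by move=> iJ Jf; rewrite -mul_mpolyC; apply: idealM. Qed.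
Lemma ideal_sum J (I : Type) (r : seq I) (P : pred I) (F : I -> {mpoly K[N]}) :
  is_ideal J -> (forall i, P i -> J (F i)) -> J (\sum_(i <- r | P i) F i).
Proof.
by move=> iJ JF; apply: (big_ind J) => //; [apply: ideal0|move=> *; apply: idealD].
Qed.

Definition add_gen J h := fun f => exists2 u, J (f - u * h) & True.

Lemma add_gen_ideal J h : is_ideal J -> is_ideal (add_gen J h).
Proof.
move=> iJ; split.
- by exists 0 => //; rewrite mul0r subr0; apply: ideal0.
- move=> f g [u Ju _] [v Jv _]; exists (u + v) => //.
  by rewrite mulrDl opprD addrACA; apply: idealD.
- move=> f g [u Ju _]; exists (f * u) => //.
  by rewrite -mulrA -mulrBr; apply: idealM.
Qed.

Lemma add_gen_sub J h f : J f -> add_gen J h f.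
Proof. by move=> Jf; exists 0; rewrite ?mul0r ?subr0. Qed.

Lemma add_gen_gen J h : is_ideal J -> add_gen J h h.
Proof. by move=> iJ; exists 1; rewrite // mul1r subrr; apply: ideal0. Qed.

End Ideals.

(** * Linear dependence in uncountable families of polynomials *)

Section Pigeonhole.
Variables (K : fieldType) (N : nat).
Hypothesis Kunc : uncountable K.

Lemma dependent_subfamily (tag : K -> nat) (a : K -> {mpoly K[N]}) :
  exists n (c l : 'I_n -> K) t,
    [/\ injective c, exists j, l j != 0, forall j, tag (c j) = t
      & \sum_j l j *: a (c j) = 0].
Proof.
have [t0 ht0] := Kunc (fun c => pickle (tag c, msize (a c))).
(* Size and tag are coded together, so a single sample [c0] reveals the size [d] shared by the whole
   class, and with it the number [D.+1] of members that forces a linear relation. *)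
have [s1 [_ ss1 st1]] := ht0 1%N.
pose c0 := nth 0 s1 0; have c0s : c0 \in s1 by rewrite mem_nth ?ss1.
pose d := msize (a c0); pose D := #|{: 'X_{1..N < d}}|.
have [s [us ss st]] := ht0 D.+1.
have hs c : c \in s -> tag c = tag c0 /\ msize (a c) = d.
  move=> /st; rewrite -(st1 _ c0s) => /(pcan_inj pickleK) [-> ->] //.
pose c (j : 'I_D.+1) := nth 0 s j.
have cs j : c j \in s by rewrite mem_nth ?ss.
pose A : 'M[K]_(D.+1, D) :=
  \matrix_(j, m) (a (c j))@_(enum_val m : 'X_{1..N < d}).
have : kermx A != 0.
  rewrite -mxrank_eq0 mxrank_ker subn_eq0 -ltnNge ltnS.
  exact: rank_leq_col.
case/rowV0Pn => l /sub_kermxP lA l0.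
exists D.+1, c, (fun j => l 0 j), (tag c0); split.
- move=> i j /eqP; rewrite nth_uniq ?ss // => /eqP; exact: val_inj.
- apply: contrapT => nl; case/eqP: l0; apply/rowP => j; rewrite mxE.
  by apply/eqP/negPn/negP => lj; apply: nl; exists j.
- by move=> j; have [] := hs _ (cs j).
- apply/mpolyP => m; rewrite mcoeff0 raddf_sum /=.
  have [md|md] := ltnP (mdeg m) d; last first.
    apply: big1 => j _; rewrite mcoeffZ (memN_msupp_eq0 (m := m)) ?mulr0 //.
    by apply: msize_mdeg_ge; have [_ ->] := hs _ (cs j).
  have /rowP/(_ (enum_rank (BMultinom md))) := lA.
  rewrite !mxE => lAm; rewrite -[RHS]lAm; apply: eq_bigr => j _.
  by rewrite mcoeffZ mxE enum_rankK.
Qed.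

End Pigeonhole.

Section Lagrange.
Variables (K : idomainType) (n : nat) (c l : 'I_n -> K).

(** The numerator of the sum of the [l j / ('X - c j)] over the common denominator; at [c j] only
    the summand [j] survives. *)
Definition lagrange_poly : {poly K} :=
  \sum_j l j *: \prod_(i | i != j) ('X - (c i)%:P).

Lemma horner_lagrange j :
  lagrange_poly.[c j] = l j * \prod_(i | i != j) (c j - c i).
Proof.
rewrite horner_sum (bigD1 j) //= [X in _ + X]big1 ?addr0 => [|k kj].
  rewrite hornerZ horner_prod; congr (_ * _).
  by apply: eq_bigr => i _; rewrite hornerXsubC.
rewrite hornerZ horner_prod (bigD1 j) 1?eq_sym //= hornerXsubC subrr.
by rewrite mul0r mulr0.
Qed.

Lemma lagrange_poly_neq0 : injective c -> (exists j, l j != 0) ->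
  lagrange_poly != 0.
Proof.
move=> ci [j lj]; apply/eqP => /(congr1 (horner^~ (c j))).
rewrite horner_lagrange horner0 => /eqP; rewrite mulf_eq0 (negbTE lj) /=.
apply/negP/prodf_neq0 => i ij; rewrite subr_eq0; apply: contra ij.
by move/eqP/ci->.
Qed.

End Lagrange.

(** * Nullstellensatz with countably many inequations *)

Section LinearCombination.
Variables (K : fieldType) (N : nat).

(** Modulo [J], [u j] plays the role of [s j / (h - c j)]; clearing denominators in the linear
    relation gives the claim. The [s j] may vary with [j], as they do in [indep_mod_descend]. *)
Lemma dependent_shift (J : {mpoly K[N]} -> Prop) (h : {mpoly K[N]})
    n (c l : 'I_n -> K) (u s : 'I_n -> {mpoly K[N]}) :
  is_ideal J -> \sum_j l j *: u j = 0 ->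
  (forall j, J (s j - u j * (h - (c j)%:MP))) ->
  J (\sum_j l j *: (s j * \prod_(i | i != j) (h - (c i)%:MP))).
Proof.
move=> iJ lu Jsu; pose H := \prod_i (h - (c i)%:MP).
suff -> : \sum_j l j *: (s j * \prod_(i | i != j) (h - (c i)%:MP)) =
    \sum_j l j *: ((s j - u j * (h - (c j)%:MP)) * \prod_(i | i != j) (h - (c i)%:MP))
    + (\sum_j l j *: u j) * H.
  rewrite lu mul0r addr0; apply: ideal_sum => // j _.
  by apply: idealZ => //; apply: idealMr.
rewrite mulr_suml -big_split; apply: eq_bigr => j _ /=.
rewrite -scalerAl -scalerDr; congr (_ *: _).
by rewrite mulrBl -mulrA /H [in X in _ + X](bigD1 j) //= subrK.
Qed.

End LinearCombination.

Section CountableNullstellensatz.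
Variables (K : closedFieldType) (N : nat).
Hypothesis Kunc : uncountable K.
Implicit Types (J : {mpoly K[N]} -> Prop) (f g h : {mpoly K[N]}).

Variable s : nat -> {mpoly K[N]}.
Hypothesis s1 : exists k, s k = 1.
Hypothesis sM : forall i j, exists k, s k = s i * s j.

Definition avoids J := forall k, ~ J (s k).

(* If no [c] worked, there would be [u_c] with [u_c * (h - c)] congruent to some
   [s k] modulo [J].  By the pigeonhole principle finitely many of the [u_c] with
   a common [k] are linearly dependent; multiplying by the product of the
   [h - c] yields a nonzero polynomial [p] with [s k * p(h)] in [J], and [p]
   splits into linear factors. *)
Lemma avoids_add_gen J h : is_ideal J -> avoids J ->
  exists c, avoids (add_gen J (h - c%:MP)).
Proof.
move=> iJ aJ; apply: contrapT => nc.
have /choice[ku hku] c : exists ku : nat * {mpoly K[N]},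
    J (s ku.1 - ku.2 * (h - c%:MP)).
  apply: contrapT => nk; apply: nc; exists c => k [u Ju _].
  by apply: nk; exists (k, u).
have [n [c [l [t [ci lj ct lu]]]]] :=
  dependent_subfamily Kunc (fun c => (ku c).1) (fun c => (ku c).2).
pose p := lagrange_poly c l.
have p0 : p != 0 by apply: lagrange_poly_neq0.
pose ev := horner_morph (fun z : K => mulrC h (mpolyC N z)).
have Jp : J (s t * ev p).
  have -> : s t * ev p =
      \sum_j l j *: (s t * \prod_(i | i != j) (h - (c i)%:MP)).
    rewrite /ev /p /lagrange_poly rmorph_sum mulr_sumr; apply: eq_bigr => j _.
    rewrite -mul_polyC rmorphM /= horner_morphC rmorph_prod mulrCA mul_mpolyC.
    congr (_ *: (_ * _)); apply: eq_bigr => i _.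
    by rewrite rmorphB /= horner_morphC horner_morphX.
  apply: (dependent_shift (s := fun=> s t) iJ lu) => j.
  by have := hku (c j); rewrite ct.
have [rs prs] := closed_field_poly_normal p.
have {}Jp : J (s t * \prod_(e <- rs) (h - e%:MP)).
  have := idealZ (lead_coef p)^-1 iJ Jp; rewrite /ev scalerAr {2}prs.
  rewrite -mul_polyC rmorphM /= horner_morphC mul_mpolyC scalerA.
  rewrite mulVf ?lead_coef_eq0 // scale1r rmorph_prod.
  congr (J (_ * _)); apply: eq_bigr => i _.
  by rewrite rmorphB /= horner_morphC horner_morphX.
(* Each linear factor [h - e] is traded for the element [s (ku e).1], congruent to a multiple of it
   modulo [J]; once no factor is left, some [s k] lies in [J]. *)
elim: rs t {prs ct} Jp => [|e rs IHrs] t.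
  by rewrite big_nil mulr1; exact: aJ.
rewrite big_cons => Jt; have [k sk] := sM t (ku e).1.
apply: (IHrs k); rewrite sk.
set G := \prod_(_ <- _) _ in Jt *.
have -> : s t * s (ku e).1 * G = (s t * G) * (s (ku e).1 - (ku e).2 * (h - e%:MP))
    + (ku e).2 * (s t * ((h - e%:MP) * G)).
  by ring.
by apply: idealD => //; apply: idealM.
Qed.

(** Adding ['X_i - c] for one coordinate after another, always avoiding the [s k], ends in an ideal
    modulo which every [f] is congruent to its value at a point [z]. That ideal is proper because 1
    is among the [s k]. *)
Lemma nullstellensatz_avoiding J : is_ideal J -> avoids J ->
  exists2 z : point K N, zero_set J z & forall k, (s k).@[z] != 0.
Proof.
move=> iJ aJ.
have [Jn [z [iJn aJn subJ Jz]]] : exists Jn (z : point K N),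
    [/\ is_ideal Jn, avoids Jn, incl J Jn & forall i, Jn ('X_i - (z i)%:MP)].
  suff /(_ N (leqnn N)) [Jn [z [? ? ? Jz]]] : forall k, (k <= N)%N ->
      exists Jn (z : point K N), [/\ is_ideal Jn, avoids Jn, incl J Jn
        & forall i : 'I_N, (i < k)%N -> Jn ('X_i - (z i)%:MP)].
    by exists Jn, z; split=> // i; apply: Jz.
  elim=> [|k IHk] kN; first by exists J, (fun=> 0); split.
  have [Jk [z [iJk aJk sJk Jkz]]] := IHk (ltnW kN).
  pose i0 := Ordinal kN; have [c ac] := avoids_add_gen 'X_i0 iJk aJk.
  exists (add_gen Jk ('X_i0 - c%:MP)), (fun i => if i == i0 then c else z i).
  split=> // [|f /sJk|i]; [exact: add_gen_ideal|exact: add_gen_sub|].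
  rewrite ltnS; case: eqP => [-> _|/eqP ii0 ik]; first exact: add_gen_gen.
  by apply/add_gen_sub/Jkz; rewrite ltn_neqAle ik andbT.
have Jev f : Jn (f - f.@[z]%:MP).
  pose A := fun f : {mpoly K[N]} => Jn (f - f.@[z]%:MP).
  have AM f1 f2 : A f1 -> A f2 -> A (f1 * f2).
    move=> A1 A2; rewrite /A mevalM mpolyCM.
    have -> : f1 * f2 - f1.@[z]%:MP * f2.@[z]%:MP =
      f2 * (f1 - f1.@[z]%:MP) + f1.@[z]%:MP * (f2 - f2.@[z]%:MP) by ring.
    by apply: idealD => //; apply: idealM.
  have A1 c : A c%:MP by rewrite /A mevalC subrr; apply: ideal0.
  have AD f1 f2 : A f1 -> A f2 -> A (f1 + f2).
    by move=> Af Ag; rewrite /A mevalD mpolyCD opprD addrACA; apply: idealD.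
  have A01 : A 0 /\ A 1.
    by split; [have := A1 0; rewrite mpolyC0|have := A1 1; rewrite mpolyC1].
  have AX i n : A ('X_i ^+ n).
    elim: n => [|n IH]; first by case: A01.
    by rewrite exprS; apply: AM => //; rewrite /A mevalXU; apply: Jz.
  rewrite -/(A f) [f]mpolyE; apply: (big_ind A) => // [|m _]; first by case: A01.
  rewrite -mul_mpolyC mpolyXE_id; apply: (AM _ _) => //.
  by apply: (big_ind A) => //; case: A01.
have Jc c : Jn c%:MP -> c = 0.
  move=> Jc; apply/eqP/negPn/negP => c0; have [k sk] := s1; apply: (aJn k).
  rewrite sk; have := idealZ c^-1 iJn Jc.
  by rewrite -mul_mpolyC -mpolyCM mulVf // mpolyC1.
exists z => [f Jf|k].
  apply: Jc; have -> : f.@[z]%:MP = f - (f - f.@[z]%:MP) by ring.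
  by apply: idealB => //; apply: subJ.
by apply/eqP => fz; apply: (aJn k); have := Jev (s k); rewrite fz subr0.
Qed.

End CountableNullstellensatz.

(** * Prime ideals and their very generic points *)

Definition is_prime_ideal (K : fieldType) N (P : {mpoly K[N]} -> Prop) :=
  [/\ is_ideal P, ~ P 1 & forall f g, P (f * g) -> P f \/ P g].

Section PrimeIdeals.
Variables (K : closedFieldType) (N : nat).
Hypothesis Kunc : uncountable K.
Implicit Types (J P : {mpoly K[N]} -> Prop) (f g h : {mpoly K[N]}).

(** The monoid generated by the [f i] is countable: its elements are indexed by codes of finite
    sequences, and a number that codes nothing stands for the empty product. *)
Lemma nullstellensatz_countable J (f : nat -> {mpoly K[N]}) :
  is_ideal J -> (forall r : seq nat, ~ J (\prod_(i <- r) f i)) ->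
  exists2 z : point K N, zero_set J z & forall k, (f k).@[z] != 0.
Proof.
move=> iJ Jf.
pose s k := \prod_(i <- odflt [::] (unpickle k : option (seq nat))) f i.
have [|i j||z Jz sz] := @nullstellensatz_avoiding K N Kunc s _ _ J iJ.
- by exists (pickle ([::] : seq nat)); rewrite /s pickleK big_nil.
- set r1 := odflt [::] (unpickle i : option (seq nat)).
  set r2 := odflt [::] (unpickle j : option (seq nat)).
  by exists (pickle (r1 ++ r2)); rewrite /s pickleK /= big_cat.
- by move=> k; apply: Jf.
exists z => // k; have := sz (pickle [:: k]).
by rewrite /s pickleK /= big_seq1.
Qed.

Lemma prime_prod P (I : Type) (r : seq I) (f : I -> {mpoly K[N]}) :
  is_prime_ideal P -> (forall i, ~ P (f i)) -> ~ P (\prod_(i <- r) f i).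
Proof.
move=> [iP P1 Pp] Pf; elim: r => [|i r IHr]; first by rewrite big_nil.
by rewrite big_cons => /Pp [/Pf|].
Qed.

Lemma prime_very_generic_point P (f : nat -> {mpoly K[N]}) :
  is_prime_ideal P -> (forall i, ~ P (f i)) ->
  exists2 z : point K N, zero_set P z & forall k, (f k).@[z] != 0.
Proof.
move=> pP Pf; apply: nullstellensatz_countable => [|r]; first by case: pP.
exact: prime_prod.
Qed.

Lemma prime_point P f : is_prime_ideal P -> ~ P f ->
  exists2 z : point K N, zero_set P z & f.@[z] != 0.
Proof.
move=> pP Pf; have [|z Pz fz] := @prime_very_generic_point P (fun=> f) pP.
  by [].
by exists z => //; apply: fz 0%N.
Qed.

Lemma prime_nullstellensatz P f : is_prime_ideal P ->
  vanishing_ideal (zero_set P) f -> P f.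
Proof.
move=> pP vf; apply: contrapT => /(prime_point pP) [z /vf ->].
by rewrite eqxx.
Qed.

Lemma nullstellensatz J f : is_ideal J -> vanishing_ideal (zero_set J) f ->
  exists k, J (f ^+ k).
Proof.
move=> iJ vf; apply: contrapT => nJ.
have [r|z Jz fz] := @nullstellensatz_countable J (fun=> f) iJ.
  by rewrite big_const_seq count_predT iter_mulr_1 => Jf; apply: nJ; exists (size r).
by have := fz 0%N; rewrite vf ?eqxx.
Qed.

End PrimeIdeals.

Lemma prime_avoiding (K : fieldType) N (J S : {mpoly K[N]} -> Prop) :
  is_ideal J -> S 1 -> (forall f g, S f -> S g -> S (f * g)) ->
  (forall f, S f -> ~ J f) ->
  exists P, [/\ is_prime_ideal P, incl J P & forall f, S f -> ~ P f].
Proof.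
move=> iJ S1 SM SJ.
pose good A := [/\ is_ideal A, incl J A & forall f, S f -> ~ A f].
have [|P [[P0|[iP JP SP]] maxP]] := @classical_sets.Zorn_bigcup {mpoly K[N]}
    (fun A => (forall f, ~ A f) \/ good A).
- move=> F Fgood Ftot; have [[X0 [f0 [FX0 Xf0]]]|no] :=
    pselect (exists X f, F X /\ X f); last first.
    by left=> f [X FX Xf]; apply: no; exists X, f.
  have gd X f : F X -> X f -> good X.
    by move=> FX Xf; have [/(_ f)|] := Fgood _ FX.
  right; have [iX0 JX0 SX0] := gd _ _ FX0 Xf0; split.
  + split; first by exists X0 => //; exact: ideal0.
      move=> f g [X FX Xf] [Y FY Yg].
      have [iX _ _] := gd _ _ FX Xf; have [iY _ _] := gd _ _ FY Yg.
      have [XY|YX] := Ftot _ _ FX FY.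
        by exists Y => //; apply: idealD => //; apply: XY.
      by exists X => //; apply: idealD => //; apply: YX.
    move=> f g [X FX Xg]; exists X => //.
    by apply: idealM => //; have [] := gd _ _ FX Xg.
  + by move=> f Jf; exists X0 => //; apply: JX0.
  + by move=> f Sf [X FX Xf]; have [_ _ /(_ f Sf)] := gd _ _ FX Xf.
- exfalso; apply: (maxP J); last by right; split=> // f.
  split; first by move=> f /P0.
  by move=> /(_ 0 (ideal0 iJ)) /P0.
exists P; split=> //; split=> // [P1|f g Pfg]; first exact: (SP 1).
have meets h : ~ P h -> exists2 f, S f & add_gen P h f.
  move=> Ph; apply: contrapT => nS; apply: (maxP (add_gen P h)).
    split; first by move=> a; exact: add_gen_sub.
    by move=> /(_ h (add_gen_gen h iP)).
  right; split; first exact: add_gen_ideal.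
    by move=> a Ja; apply/add_gen_sub/JP.
  by move=> a Sa Pa; apply: nS; exists a.
apply: contrapT => /not_orP [/meets [a Sa [u Pu _]] /meets [b Sb [v Pv _]]].
apply: (SP _ (SM _ _ Sa Sb)).
have -> : a * b = b * (a - u * f) + (u * f) * (b - v * g) + (u * v) * (f * g).
  by ring.
by apply: idealD => //; [apply: idealD => //|]; apply: idealM.
Qed.

(** * Function fields *)

Lemma fraction_numden (R : idomainType) (x : {fraction R}) :
  exists a b : R, b != 0 /\ x = FracField.tofrac a / FracField.tofrac b.
Proof.
elim/quotW: x => y; exists \n_y, \d_y; split; first exact: denom_ratioP.
apply: (mulIf (x := FracField.tofrac \d_y)).
  by rewrite tofrac_eq0 denom_ratioP.
rewrite divfK ?tofrac_eq0 ?denom_ratioP //; apply/eqP.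
rewrite !piE FracField.equivfE /FracField.mulf.
by rewrite !numden_Ratio ?mulf_neq0 ?oner_neq0 ?denom_ratioP // !mulr1 mulrC.
Qed.

Section FractionFieldOfPrimeQuotient.
Variables (R : comNzRingType) (P : R -> Prop).
Hypothesis P0 : P 0.
Hypothesis P1 : ~ P 1.
Hypothesis PMD : forall a u v, P u -> P v -> P (a * u + v).
Hypothesis Pprime : forall u v, P (u * v) -> P u \/ P v.

Definition primeb : {pred R} := fun u => `[< P u >].

Fact primeb_closed : idealr_closed primeb.
Proof.
split; first exact/asboolP.
  by apply/asboolP.
by move=> a u v /asboolP Pu /asboolP Pv; apply/asboolP/PMD.
Qed.

Fact primeb_prime : prime_idealr_closed primeb.
Proof.
move=> u v /asboolP/Pprime [Pu|Pv]; apply/orP; [left|right]; exact/asboolP.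
Qed.

HB.instance Definition _ := isIdealr.Build R primeb primeb_closed.
HB.instance Definition _ := isPrimeIdealrClosed.Build R primeb primeb_prime.

Definition prime_quot := {ideal_quot primeb}.
HB.instance Definition _ := GRing.ComNzRing.on prime_quot.

(** The construction of fractions starts from an integral domain with a unit test and an inverse;
    both are chosen classically here. *)
Definition quot_unit : {pred prime_quot} := fun x => `[< exists y, y * x = 1 >].
Definition quot_inv (x : prime_quot) : prime_quot :=
  if pselect (exists y, y * x = 1) is left h then projT1 (cid h) else x.

Fact quot_mulVx : {in quot_unit, left_inverse 1 quot_inv *%R}.
Proof.
move=> x /asboolP xu; rewrite /quot_inv; case: pselect => // h.
exact: projT2 (cid h).
Qed.
Fact quot_unitPl (x y : prime_quot) : y * x = 1 -> quot_unit x.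
Proof. by move=> yx; apply/asboolP; exists y. Qed.
Fact quot_inv_out : {in [predC quot_unit], quot_inv =1 id}.
Proof.
move=> x; rewrite inE /quot_inv => /asboolP xu; case: pselect => // h.
Qed.

HB.instance Definition _ := GRing.ComNzRing_hasMulInverse.Build prime_quot
  quot_mulVx quot_unitPl quot_inv_out.

Fact quot_idomain : GRing.integral_domain_axiom prime_quot.
Proof. exact: Quotient.rquot_IdomainAxiom. Qed.
HB.instance Definition _ := GRing.ComUnitRing_isIntegral.Build prime_quot
  quot_idomain.

Lemma fraction_field_of_prime :
  exists (E : fieldType) (phi : {rmorphism R -> E}),
    (forall u, phi u = 0 <-> P u) /\
    forall x, exists u v, phi v != 0 /\ x = phi u / phi v.
Proof.
pose pq : {rmorphism R -> prime_quot} := \pi_prime_quot%qT.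
pose phi : {rmorphism R -> {fraction prime_quot}} :=
  [the {rmorphism _ -> _} of @FracField.tofrac prime_quot \o pq].
have phi0 u : phi u = 0 <-> P u.
  have e : (phi u == 0) = (u \in primeb).
    rewrite /phi /= tofrac_eq0 -[u in RHS]subr0 Quotient.idealrBE.
    by rewrite -(rmorph0 pq).
  by split=> [/eqP|/asboolP up]; [rewrite e => /asboolP|apply/eqP; rewrite e].
exists {fraction prime_quot}, phi; split=> // x.
suff [a [b [b0 ->]]] : exists a b : prime_quot,
    b != 0 /\ x = FracField.tofrac a / FracField.tofrac b.
  exists (repr a), (repr b).
  have phiE (c : prime_quot) : phi (repr c) = FracField.tofrac c.
    by rewrite /phi /= /pq /= reprK.
  by rewrite !phiE tofrac_eq0.
exact: fraction_numden.
Qed.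

End FractionFieldOfPrimeQuotient.

Lemma function_field (K : fieldType) N (P : {mpoly K[N]} -> Prop) :
  is_prime_ideal P ->
  exists (E : fieldType) (phi : {rmorphism {mpoly K[N]} -> E}),
    (forall f, phi f = 0 <-> P f) /\
    forall x, exists f g, phi g != 0 /\ x = phi f / phi g.
Proof.
move=> [iP P1 Pp]; apply: fraction_field_of_prime => //; first exact: ideal0.
by move=> a u v Pu Pv; apply: idealD => //; apply: idealM.
Qed.

Section ExtendDerivation.
Variables (R : comNzRingType) (E : fieldType) (phi : {rmorphism R -> E}).
Hypothesis phi_frac : forall x, exists f g, phi g != 0 /\ x = phi f / phi g.
Variable D : R -> R.
Hypothesis DD : {morph D : f g / f + g}.
Hypothesis DM : forall f g, D (f * g) = f * D g + D f * g.
Hypothesis Dker : forall f, phi f = 0 -> phi (D f) = 0.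

(** The value at [x = a / b] is forced by differentiating [a = x b]. It does not depend on the
    fraction: [a * b' - a' * b] is in the kernel of [phi], and by [Dker] so is its derivative. *)
Lemma extend_derivation : exists delta : E -> E,
  [/\ {morph delta : x y / x + y},
      forall x y, delta (x * y) = x * delta y + delta x * y
    & forall f, delta (phi f) = phi (D f)].
Proof.
have /choice[ab hab] x : exists ab, phi ab.2 != 0 /\ x = phi ab.1 / phi ab.2.
  by have [a [b ?]] := phi_frac x; exists (a, b).
pose delta x := (phi (D (ab x).1) - x * phi (D (ab x).2)) / phi (ab x).2.
have D0 : D 0 = 0.
  by have := DD 0 0; rewrite addr0 => /eqP; rewrite -subr_eq0 opprD addNKr oppr_eq0 => /eqP.
have DN f : D (- f) = - D f by apply/eqP; rewrite -addr_eq0 -DD addNr D0.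
have deltaE a b : phi b != 0 ->
    delta (phi a / phi b) = (phi (D a) - phi a / phi b * phi (D b)) / phi b.
  move=> b0; rewrite /delta; set x := phi a / phi b.
  have [b'0 xE'] := hab x; set a' := (ab x).1 in xE' *; set b' := (ab x).2 in b'0 xE' *.
  have aE : phi a = x * phi b by rewrite divfK.
  have a'E : phi a' = x * phi b' by rewrite xE' divfK.
  have : phi (D (a * b' - a' * b)) = 0.
    by apply: Dker; rewrite rmorphB !rmorphM /= aE a'E mulrAC subrr.
  rewrite DD DN !DM rmorphB !rmorphD !rmorphM /= aE a'E => h.
  apply: (mulIf b'0); apply: (mulIf b0); rewrite divfK // [RHS]mulrAC divfK //.
  apply/eqP; rewrite -subr_eq0 -oppr_eq0 -h; apply/eqP; ring.
have D1 : D 1 = 0.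
  by have := DM 1 1; rewrite !mul1r mulr1 => /eqP; rewrite addrC -subr_eq subrr => /eqP.
exists delta; split=> [x y|x y|f].
- have [a [b [b0 ->]]] := phi_frac x; have [c [d [d0 ->]]] := phi_frac y.
  have -> : phi a / phi b + phi c / phi d = phi (a * d + c * b) / phi (b * d).
    by rewrite rmorphD !rmorphM addf_div.
  rewrite !deltaE ?rmorphM ?mulf_neq0 // DD !DM !(rmorphD, rmorphM) /=.
  by field; rewrite b0 d0.
- have [a [b [b0 ->]]] := phi_frac x; have [c [d [d0 ->]]] := phi_frac y.
  have -> : phi a / phi b * (phi c / phi d) = phi (a * c) / phi (b * d).
    by rewrite !rmorphM mulf_div.
  rewrite !deltaE ?rmorphM ?mulf_neq0 // !DM !(rmorphD, rmorphM) /=.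
  by field; rewrite b0 d0.
- have := deltaE f 1; rewrite rmorph1 oner_eq0 !divr1 D1 rmorph0 mulr0 subr0.
  by apply.
Qed.

End ExtendDerivation.

(** * Algebraic dependence *)

Inductive field_gen (E : fieldType) (S : E -> Prop) : E -> Prop :=
| field_gen_in x of S x : field_gen S x
| field_gen1 : field_gen S 1
| field_genB x y of field_gen S x & field_gen S y : field_gen S (x - y)
| field_genM x y of field_gen S x & field_gen S y : field_gen S (x * y)
| field_genV x of field_gen S x : field_gen S x^-1.

Section GeneratedField.
Variables (E : fieldType) (S : E -> Prop).

Definition field_genb : {pred E} := fun x => `[< field_gen S x >].

Fact field_genb_closed : divring_closed field_genb.
Proof.
split=> [|x y /asboolP gx /asboolP gy|x y /asboolP gx /asboolP gy]; apply/asboolP.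
- exact: field_gen1.
- exact: field_genB.
- by apply: field_genM => //; apply: field_genV.
Qed.

HB.instance Definition _ := GRing.isDivringClosed.Build E field_genb
  field_genb_closed.

(** The generated field as a type of its own, so that closure properties of algebraic elements over
    a subfield transfer to [acl] through [aclE]. *)
Record gen_field := GenField { gen_val :> E; _ : gen_val \in field_genb }.
HB.instance Definition _ := [isSub for gen_val].
HB.instance Definition _ := [Choice of gen_field by <:].
HB.instance Definition _ := [SubChoice_isSubIntegralDomain of gen_field by <:].
HB.instance Definition _ := [SubIntegralDomain_isSubField of gen_field by <:].

Lemma field_genP x : field_gen S x <-> x \in field_genb.
Proof. by split=> /asboolP. Qed.

Lemma field_gen0 : field_gen S 0.
Proof. by apply/field_genP/rpred0. Qed.

Lemma field_genD x y : field_gen S x -> field_gen S y -> field_gen S (x + y).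
Proof. by move=> /field_genP gx /field_genP gy; apply/field_genP/rpredD. Qed.

Lemma field_gen_sum (I : Type) (r : seq I) (P : pred I) (f : I -> E) :
  (forall i, P i -> field_gen S (f i)) -> field_gen S (\sum_(i <- r | P i) f i).
Proof. by move=> h; apply/field_genP/rpred_sum => i /h /field_genP. Qed.

Lemma field_gen_prod (I : Type) (r : seq I) (P : pred I) (f : I -> E) :
  (forall i, P i -> field_gen S (f i)) -> field_gen S (\prod_(i <- r | P i) f i).
Proof. by move=> h; apply/field_genP/rpred_prod => i /h /field_genP. Qed.

Lemma field_genX x n : field_gen S x -> field_gen S (x ^+ n).
Proof. by move=> /field_genP gx; apply/field_genP/rpredX. Qed.

Definition acl (x : E) := exists p : {poly E},
  [/\ p != 0, forall i, field_gen S p`_i & root p x].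

Let FtoE : {rmorphism gen_field -> E} := val.

Lemma aclE x : acl x <-> algebraicOver FtoE x.
Proof.
split=> [[p [p0 gp px]]|[p p0 px]].
  have [q pq] : exists q, p = map_poly FtoE q.
    exists (\poly_(i < size p) insubd 0 p`_i); apply/polyP => i.
    rewrite coef_map coef_poly; case: ltnP => [_|/leq_sizeP -> //].
    by rewrite /FtoE /= insubdK //; apply/field_genP.
  by exists q; [move: p0; rewrite pq map_poly_eq0|rewrite -pq].
exists (map_poly FtoE p); split; rewrite ?map_poly_eq0 // => i.
by rewrite coef_map; apply/field_genP/valP.
Qed.

Lemma acl_gen x : field_gen S x -> acl x.
Proof.
move=> gx; exists ('X - x%:P); rewrite polyXsubC_eq0 root_XsubC; split=> // i.
rewrite coefB coefX coefC; apply: field_genB.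
  by case: (_ == _); [exact: field_gen1|exact: field_gen0].
by case: ifP => _ //; exact: field_gen0.
Qed.

Lemma acl0 : acl 0. Proof. exact/acl_gen/field_gen0. Qed.
Lemma acl1 : acl 1. Proof. exact/acl_gen/field_gen1. Qed.
Lemma aclD x y : acl x -> acl y -> acl (x + y).
Proof. by move=> /aclE ax /aclE ay; apply/aclE/algebraic_add. Qed.
Lemma aclB x y : acl x -> acl y -> acl (x - y).
Proof. by move=> /aclE ax /aclE ay; apply/aclE/algebraic_sub. Qed.
Lemma aclM x y : acl x -> acl y -> acl (x * y).
Proof. by move=> /aclE ax /aclE ay; apply/aclE/algebraic_mul. Qed.
Lemma aclV x : acl x -> acl x^-1.
Proof. by move=> /aclE ax; apply/aclE/algebraic_inv. Qed.

Lemma acl_root (p : {poly E}) x : p != 0 -> (forall i, acl p`_i) -> root p x -> acl x.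
Proof.
move=> p0 ap px; apply/aclE/integral_algebraic.
apply: (integral_root p0 px) => _ /(nthP 0) [i _ <-].
exact/integral_algebraic/aclE.
Qed.

End GeneratedField.

(** * Exchange property and Steinitz's theorem for algebraic dependence *)

Section ClosureOperator.
Variable E : fieldType.
Implicit Types (S T : E -> Prop) (a b x y : E).

Lemma field_gen_mono S T x : (forall y, S y -> field_gen T y) ->
  field_gen S x -> field_gen T x.
Proof.
move=> ST; elim=> {x} [x /ST //||||].
- exact: field_gen1.
- by move=> *; apply: field_genB.
- by move=> *; apply: field_genM.
- by move=> *; apply: field_genV.
Qed.

Lemma acl_in S x : S x -> acl S x.
Proof. by move=> Sx; apply/acl_gen/field_gen_in. Qed.

Lemma acl_trans S T x : (forall y, S y -> acl T y) -> acl S x -> acl T x.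
Proof.
move=> ST; have gST y : field_gen S y -> acl T y.
  elim=> {y} [y /ST //||y z _ aly _ alz|y z _ aly _ alz|y _ aly].
  - exact: acl1.
  - exact: aclB.
  - exact: aclM.
  - exact: aclV.
by case=> p [p0 gp px]; apply: acl_root p0 _ px => i; apply: gST.
Qed.

Lemma acl_mono S T x : (forall y, S y -> T y) -> acl S x -> acl T x.
Proof. by move=> ST; apply: acl_trans => y /ST; apply: acl_in. Qed.

Definition adjoin S a : E -> Prop := fun x => S x \/ x = a.

Definition over S (p : {poly E}) := forall i, field_gen S p`_i.

Lemma overB S (p q : {poly E}) : over S p -> over S q -> over S (p - q).
Proof. by move=> op oq i; rewrite coefB; apply: field_genB. Qed.
Lemma overM S (p q : {poly E}) : over S p -> over S q -> over S (p * q).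
Proof.
by move=> op oq i; rewrite coefM; apply: field_gen_sum => j _; apply: field_genM.
Qed.
Lemma overC S c : field_gen S c -> over S c%:P.
Proof. by move=> gc i; rewrite coefC; case: ifP => // _; apply: field_gen0. Qed.
Lemma over_prod S (I : Type) (r : seq I) (P : pred I) (F : I -> {poly E}) :
  (forall i, P i -> over S (F i)) -> over S (\prod_(i <- r | P i) F i).
Proof.
move=> oF; apply: (big_ind (over S)) => //; last by move=> *; apply: overM.
exact/overC/field_gen1.
Qed.

Lemma adjoin_fraction S b x : field_gen (adjoin S b) x ->
  exists p q, [/\ over S p, over S q, q.[b] != 0 & x = p.[b] / q.[b]].
Proof.
have o1 : over S 1 by exact/overC/field_gen1.
elim=> {x} [x [Sx|->]||x y _ [p [q [op oq q0 ->]]] _ [p' [q' [op' oq' q0' ->]]]|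
  x y _ [p [q [op oq q0 ->]]] _ [p' [q' [op' oq' q0' ->]]]|x _ [p [q [op oq q0 ->]]]].
- exists x%:P, 1; rewrite !hornerE oner_eq0 ?invr1 ?mulr1; split=> //.
  exact/overC/field_gen_in.
- exists 'X, 1; rewrite !hornerE oner_eq0 ?invr1 ?mulr1; split=> // i.
  by rewrite coefX; case: (_ == _); [exact: field_gen1|exact: field_gen0].
- by exists 1, 1; rewrite !hornerE oner_eq0 ?invr1 ?mulr1.
- exists (p * q' - p' * q), (q * q');
  rewrite !(hornerD, hornerN, hornerM) mulf_neq0 //; split=> //.
  + by apply: overB; apply: overM.
  + exact: overM.
  + by rewrite -mulNr addf_div // mulNr.
- exists (p * p'), (q * q'); rewrite !hornerM mulf_neq0 // mulf_div.
  by split=> //; apply: overM.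
- have [p0|p0] := eqVneq p.[b] 0.
    exists 0, 1; rewrite !hornerE oner_eq0 p0 !mul0r invr0; split=> //.
    exact/overC/field_gen0.
  by exists q, p; rewrite invf_div.
Qed.

(** Clearing denominators in the equation of [a] gives a polynomial relation over [S] between [a]
    and [b], read as a polynomial [r] in [b] with coefficients involving [a]. If [r] is nonzero, [b]
    is algebraic; if it is zero, its coefficients are equations for [a] over [S]. *)
Lemma acl_exchange S a b : acl (adjoin S b) a -> ~ acl S a -> acl (adjoin S a) b.
Proof.
case=> p [p0 gp pa] nSa.
have /choice[nd hnd] i : exists nd : {poly E} * {poly E},
    [/\ over S nd.1, over S nd.2, nd.2.[b] != 0 & p`_i = nd.1.[b] / nd.2.[b]].
  by have [u [v h]] := adjoin_fraction (gp i); exists (u, v).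
pose n := size p; pose q i := (nd i).1 * \prod_(j < n | j != i :> nat) (nd j).2.
pose d := \prod_(j < n) (nd j).2.[b].
have oq i : over S (q i).
  by apply: overM; [have [] := hnd i|apply: over_prod => j _; have [] := hnd j].
have qb i : (i < n)%N -> (q i).[b] = p`_i * d.
  move=> ni; have [_ _ d0 ->] := hnd i.
  rewrite /d (bigD1 (Ordinal ni)) //= mulrA divfK // hornerM horner_prod.
  by congr (_ * _); apply: eq_bigl => j.
have d0 : d != 0 by apply/prodf_neq0 => j _; have [] := hnd j.
pose r := \sum_(i < n) a ^+ i *: q i.
have rb : r.[b] = 0.
  rewrite horner_sum; transitivity (d * p.[a]); last by rewrite (rootP pa) mulr0.
  rewrite horner_coef mulr_sumr; apply: eq_bigr => i _.
  by rewrite hornerZ qb //; ring.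
have [r0|r0] := eqVneq r 0; last first.
  exists r; split; rewrite // ?/root ?rb // => i.
  rewrite coef_sum; apply: field_gen_sum => j _; rewrite coefZ; apply: field_genM.
    by apply: field_genX; apply: field_gen_in; right.
  by apply: field_gen_mono (oq j i) => y Sy; apply: field_gen_in; left.
have n0 : (n.-1 < n)%N by rewrite prednK // size_poly_gt0.
have : q n.-1 != 0.
  apply: contra_neq p0 => q0; apply/eqP; rewrite -lead_coef_eq0 lead_coefE.
  have := qb _ n0; rewrite q0 horner0 => /esym/eqP.
  by rewrite mulf_eq0 (negPf d0) orbF.
rewrite -lead_coef_eq0 lead_coefE; set k := (size _).-1 => qk.
(* Since [r = 0], the coefficients of degree [k] of the [q i] form a polynomial over [S] vanishing
   at [a]; taking for [k] the degree of [q n.-1] makes it nonzero. *)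
case: nSa; exists (\poly_(i < n) (q i)`_k); split.
- apply: contraNneq qk => /polyP/(_ n.-1).
  by rewrite coef_poly n0 coef0 => ->.
- move=> i; rewrite coef_poly; case: ifP => _; [exact: oq|exact: field_gen0].
- rewrite /root horner_poly; move/polyP/(_ k): r0; rewrite coef_sum coef0 => rk.
  by rewrite -[X in _ == X]rk; apply/eqP/eq_bigr => i _; rewrite coefZ mulrC.
Qed.

Definition adjoins S (u : seq E) : E -> Prop := fun x => S x \/ x \in u.

(** Algebraic independence of a list over [S] (not linear dependence): each entry is transcendental
    over [S] and the entries after it. That the order is immaterial rests on exchange. *)
Fixpoint lindep S (u : seq E) : Prop :=
  if u is a :: u' then ~ acl (adjoins S u') a /\ lindep S u' else True.

Lemma adjoins_cons S a u x : adjoins S (a :: u) x <-> adjoin (adjoins S u) a x.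
Proof.
split=> [[Sx|]|[[Sx|xu]|->]]; rewrite /adjoin /adjoins ?inE ?eqxx ?xu ?orbT; auto.
by case/orP => [/eqP|]; auto.
Qed.

Lemma acl_adjoins_cons S a u x :
  acl (adjoins S (a :: u)) x <-> acl (adjoin (adjoins S u) a) x.
Proof. by split; apply: acl_mono => y /adjoins_cons. Qed.

Lemma eq_lindep_cat S u v v' : v =i v' -> lindep S v' ->
  lindep S (u ++ v) -> lindep S (u ++ v').
Proof.
move=> vv' iv'; elim: u => //= a u IHu [na /IHu ?]; split=> //.
apply: contra_not na; apply: acl_mono => x [Sx|xu]; [by left|right].
by move: xu; rewrite !mem_cat vv'.
Qed.

Lemma lindep_catr S u v : lindep S (u ++ v) -> lindep S v.
Proof. by elim: u => //= a u IHu [_ /IHu]. Qed.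

(** If an entry [b] became algebraic once [a] stands behind it, exchange would make [a] algebraic
    over the others. *)
Lemma lindep_insert S a u v : lindep S (a :: u ++ v) -> lindep S (u ++ a :: v).
Proof.
elim: u => //= b u IHu [na [nb iuv]]; split; last first.
  apply: IHu; split=> //; apply: contra_not na.
  apply: acl_mono => x [Sx|xu]; [by left|right].
  by rewrite inE xu orbT.
move=> ab; apply: na; apply/acl_adjoins_cons; apply: acl_exchange nb.
apply: acl_mono ab => x [Sx|]; first by left; left.
rewrite mem_cat inE => /or3P [xu|/eqP->|xv]; [left|by right|left]; right.
  by rewrite mem_cat xu.
by rewrite mem_cat xv orbT.
Qed.

(* [v] collects the elements of [u] already exchanged into [t]. *)
Lemma steinitz S t u v : lindep S (u ++ v) ->
  (forall x, x \in u -> acl (adjoins S (t ++ v)) x) -> (size u <= size t)%N.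
Proof.
elim: t u v => [|b t IHt] u v iuv ut.
  case: u iuv ut => //= a u [na _] /(_ a); rewrite inE eqxx => /(_ isT) av.
  by case: na; apply: acl_mono av => x [Sx|xv]; [left|right; rewrite mem_cat xv orbT].
have [all_t|] := pselect (forall x, x \in u -> acl (adjoins S (t ++ v)) x).
  exact: leq_trans (IHt u v iuv all_t) (leqnSn _).
move=> /existsNP [a /not_implyP [au na]].
have ab : acl (adjoins S (a :: t ++ v)) b.
  apply/acl_adjoins_cons; apply: acl_exchange na.
  by have /acl_adjoins_cons := ut a au.
case/splitPr: au iuv ut => u1 u2; rewrite -catA /= => iuv ut.
rewrite size_cat /= addnS ltnS -size_cat; apply: (IHt _ (a :: v)).
  rewrite -catA; apply: (eq_lindep_cat (v := a :: u2 ++ v) _ _ iuv).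
    by move=> x; rewrite inE !mem_cat inE orbCA.
  by apply: lindep_insert; apply: lindep_catr iuv.
move=> x xu; have := ut x; rewrite mem_cat inE orbCA -mem_cat xu orbT => /(_ isT).
apply: acl_trans => y [Sy|]; first by apply: acl_in; left.
rewrite inE => /orP [/eqP->|ytv].
  apply: acl_mono ab => z [Sz|zt]; [by left|right].
  by rewrite mem_cat inE orbCA -mem_cat -in_cons.
by apply: acl_in; right; rewrite mem_cat inE orbCA -mem_cat ytv orbT.
Qed.

(** The lower bound in the additivity of transcendence degrees: [v] inside [S'] is independent over
    [S], and [u] is independent over [S']. *)
Lemma lindep_extend S S' u v : lindep S' u -> (forall x, S x -> S' x) ->
  (forall x, x \in v -> S' x) -> lindep S v -> lindep S (u ++ v).
Proof.
move=> iu SS' vS' iv; elim: u iu => //= a u IHu [na /IHu ?]; split=> //.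
apply: contra_not na; apply: acl_mono => x [Sx|]; first by left; apply: SS'.
by rewrite mem_cat => /orP [xu|/vS' ?]; [right|left].
Qed.

End ClosureOperator.

(** * Polynomials as univariate polynomials in their last variable *)

Section LastVariable.
Variable E : comNzRingType.

Local Notation wid := (widen_ord (leqnSn _)).

Lemma muniX k (m : 'X_{1..k.+1}) :
  muni ('X_[m] : {mpoly E[k.+1]}) = 'X_[[multinom m (wid i) | i < k]] *: 'X^(m ord_max).
Proof. by rewrite muniE msuppX big_seq1 mcoeffX eqxx scale1r. Qed.

Lemma mcoeff_muni k (H : {mpoly E[k.+1]}) (m : 'X_{1..k.+1}) :
  ((muni H)`_(m ord_max))@_[multinom m (wid i) | i < k] = H@_m.
Proof.
rewrite muniE coef_sum raddf_sum /= [in RHS](mpolyE H) raddf_sum /=.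
apply: eq_bigr => n _; rewrite coefZ coefXn -scalerAl !mcoeffZ mcoeffX; congr (_ * _).
have [->|nm] := eqVneq n m; first by rewrite !eqxx mulr1 mcoeffX eqxx.
have [mn|] := eqVneq (m ord_max) (n ord_max); last by rewrite mulr0 mcoeff0.
rewrite mulr1 mcoeffX; case: eqP => // /mnmP e; case/eqP: nm.
apply/mnmP => i; have [->|ni] := eqVneq i ord_max; first by [].
have ik : (i < k)%N by rewrite ltn_neqAle -ltnS ltn_ord andbT; move: ni.
have := e (Ordinal ik); rewrite !mnmE.
by have -> : wid (Ordinal ik) = i by exact: val_inj.
Qed.

Lemma muni_eq0 k (H : {mpoly E[k.+1]}) : muni H = 0 -> H = 0.
Proof.
by move=> H0; apply/mpolyP => m; rewrite -mcoeff_muni H0 coef0 !mcoeff0.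
Qed.

Lemma mmap_muni k (A : comNzRingType) (g : {rmorphism E -> A}) (u : 'I_k.+1 -> A)
    (H : {mpoly E[k.+1]}) :
  mmap g u H = (map_poly (mmap g (fun i => u (wid i))) (muni H)).[u ord_max].
Proof.
rewrite [H in LHS]mpolyE [in RHS]muniE !raddf_sum /= horner_sum.
apply: eq_bigr => m _; rewrite mmapZ map_polyZ /= map_polyXn hornerZ hornerXn.
rewrite mmapZ !mmapX -mulrA; congr (_ * _).
by rewrite /mmap1 big_ord_recr; congr (_ * _); apply: eq_bigr => i _; rewrite mnmE.
Qed.

Lemma muni_mwiden k (q : {mpoly E[k]}) : muni (mwiden q) = q%:P.
Proof.
rewrite (mwidenE (leqnn (msize q))) [q in RHS](mpolywE (leqnn (msize q))) !raddf_sum /=.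
apply: eq_bigr => m _; rewrite muniZ muniX mnmwiden_ordmax.
rewrite expr0 alg_polyC -mul_polyC -polyCM mul_mpolyC; congr (_ *: 'X_[_])%:P.
by apply/mnmP => i; rewrite mnmE mnmwiden_widen.
Qed.

Lemma muni_Xmax k : muni ('X_ord_max : {mpoly E[k.+1]}) = 'X.
Proof.
rewrite muniX mnm1E eqxx expr1.
have -> : [multinom (U_(ord_max)%MM : 'X_{1..k.+1}) (wid i) | i < k] = 0%MM.
  apply/mnmP => i; rewrite mnmE mnm1E mnm0E; case: eqP => // /(congr1 val) /= e.
  by have := ltn_ord i; rewrite -e ltnn.
by rewrite mpolyX0 scale1r.
Qed.

End LastVariable.

(** * Independence of tuples, by polynomial relations, and of lists *)

Section AlgebraicIndependence.
Variable E : fieldType.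
Implicit Types (S : E -> Prop).

Local Notation wid := (widen_ord (leqnSn _)).

(* The last entry comes first, since [muni] singles out the last variable. *)
Fixpoint olist k : ('I_k -> E) -> seq E :=
  if k is k'.+1 then fun u => u ord_max :: olist (fun i : 'I_k' => u (wid i))
  else fun=> [::].

Lemma size_olist k (u : 'I_k -> E) : size (olist u) = k.
Proof. by elim: k u => //= k IHk u; rewrite IHk. Qed.

Lemma mem_olist k (u : 'I_k -> E) x : x \in olist u <-> exists i, x = u i.
Proof.
elim: k u x => [|k IHk] u x /=; first by split=> // [[[]]].
rewrite inE; split=> [/orP [/eqP->|/IHk [i ->]]|[i ->]]; try by eexists.
have [->|ni] := eqVneq i ord_max; first by rewrite eqxx.
have ik : (i < k)%N by rewrite ltn_neqAle -ltnS ltn_ord andbT; move: ni.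
apply/orP; right; apply/IHk; exists (Ordinal ik); congr u; exact: val_inj.
Qed.

Definition overm S k (H : {mpoly E[k]}) := forall m, field_gen S H@_m.

Definition aindep S k (u : 'I_k -> E) :=
  forall H : {mpoly E[k]}, overm S H -> H.@[u] = 0 -> H = 0.

Section Overm.
Variables (S : E -> Prop) (k : nat).
Implicit Types (p q : {mpoly E[k]}).

Lemma overm0 : overm S (0 : {mpoly E[k]}).
Proof. by move=> m; rewrite mcoeff0; apply: field_gen0. Qed.
Lemma overmD p q : overm S p -> overm S q -> overm S (p + q).
Proof. by move=> op oq m; rewrite mcoeffD; apply: field_genD. Qed.
Lemma overmB p q : overm S p -> overm S q -> overm S (p - q).
Proof. by move=> op oq m; rewrite mcoeffB; apply: field_genB. Qed.
Lemma overmZ c p : field_gen S c -> overm S p -> overm S (c *: p).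
Proof. by move=> op oq m; rewrite mcoeffZ; apply: field_genM. Qed.
Lemma overmX (m : 'X_{1..k}) : overm S 'X_[m].
Proof.
by move=> n; rewrite mcoeffX; case: (_ == _); [exact: field_gen1|exact: field_gen0].
Qed.
Lemma overm1 : overm S (1 : {mpoly E[k]}).
Proof. by rewrite -mpolyX0; apply: overmX. Qed.
Lemma overmC c : field_gen S c -> overm S (c%:MP : {mpoly E[k]}).
Proof. by move=> gc; rewrite -alg_mpolyC; apply: overmZ => //; apply: overm1. Qed.
Lemma overmM p q : overm S p -> overm S q -> overm S (p * q).
Proof.
move=> op oq m; rewrite mcoeffM; apply: field_gen_sum => i _; exact: field_genM.
Qed.
Lemma overm_sum (I : Type) (r : seq I) (P : pred I) (F : I -> {mpoly E[k]}) :
  (forall i, P i -> overm S (F i)) -> overm S (\sum_(i <- r | P i) F i).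
Proof.
by move=> oF; apply: (big_ind (@overm S k)) => //; [exact: overm0|exact: overmD].
Qed.
Lemma overm_prod (I : Type) (r : seq I) (P : pred I) (F : I -> {mpoly E[k]}) :
  (forall i, P i -> overm S (F i)) -> overm S (\prod_(i <- r | P i) F i).
Proof.
by move=> oF; apply: (big_ind (@overm S k)) => //; [exact: overm1|exact: overmM].
Qed.

Lemma adjoins_fraction (u : 'I_k -> E) x : field_gen (adjoins S (olist u)) x ->
  exists p q, [/\ overm S p, overm S q, q.@[u] != 0 & x = p.@[u] / q.@[u]].
Proof.
have o1 := overm1.
elim=> {x} [x [Sx|/mem_olist [i ->]]||x y _ [p [q [op oq q0 ->]]] _ [p' [q' [op' oq' q0' ->]]]|
  x y _ [p [q [op oq q0 ->]]] _ [p' [q' [op' oq' q0' ->]]]|x _ [p [q [op oq q0 ->]]]].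
- exists x%:MP, 1; rewrite mevalC meval1 oner_eq0 divr1; split=> //.
  exact/overmC/field_gen_in.
- exists 'X_i, 1; rewrite mevalXU meval1 oner_eq0 divr1; split=> //.
  exact: overmX.
- by exists 1, 1; rewrite meval1 oner_eq0 divr1.
- exists (p * q' - p' * q), (q * q'); rewrite !(mevalB, mevalM) mulf_neq0 //.
  split=> //; [by apply: overmB; apply: overmM|exact: overmM|].
  by rewrite -mulNr addf_div // mulNr.
- exists (p * p'), (q * q'); rewrite !mevalM mulf_neq0 // mulf_div.
  by split=> //; apply: overmM.
- have [p0|p0] := eqVneq p.@[u] 0.
    exists 0, 1; rewrite meval1 meval0 oner_eq0 p0 !mul0r invr0; split=> //.
    exact: overm0.
  by exists q, p; rewrite invf_div.
Qed.

Lemma field_gen_meval (u : 'I_k -> E) p :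
  overm S p -> field_gen (adjoins S (olist u)) p.@[u].
Proof.
move=> op; rewrite mevalE; apply: field_gen_sum => m _; apply: field_genM.
  by apply: field_gen_mono (op m) => y Sy; apply: field_gen_in; left.
apply: field_gen_prod => i _; apply/field_genX/field_gen_in; right.
by apply/mem_olist; exists i.
Qed.

End Overm.

Lemma meval_muni k (u : 'I_k.+1 -> E) (H : {mpoly E[k.+1]}) :
  H.@[u] = (map_poly (meval (fun i => u (wid i))) (muni H)).[u ord_max].
Proof. exact: (mmap_muni idfun). Qed.

Lemma overm_mwiden S k (q : {mpoly E[k]}) : overm S q -> overm S (mwiden q).
Proof.
move=> oq; rewrite (mwidenE (k := msize q)) //; apply: overm_sum => m _.
by apply: overmZ => //; apply: overmX.
Qed.

Lemma overm_muni S k (H : {mpoly E[k.+1]}) i : overm S H -> overm S (muni H)`_i.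
Proof.
move=> oH; rewrite muniE coef_sum; apply: overm_sum => m _.
rewrite coefZ coefXn; apply: overmM.
  by apply: overmZ => //; apply: overmX.
by case: (_ == _); [exact: overm1|exact: overm0].
Qed.

(** Splitting off the last variable turns a relation into a univariate polynomial over the field
    generated by the other entries. Conversely, denominators in such a polynomial are cleared, as in
    [acl_exchange], to obtain a relation with coefficients over [S]. *)
Lemma aindep_lindep S k (u : 'I_k -> E) : aindep S u <-> lindep S (olist u).
Proof.
elim: k u => [|k IHk] u /=.
  split=> // _ H _; rewrite (nvar0_mpolyC H) mevalC => ->.
  by rewrite mpolyC0.
set u' := fun i => u (wid i); set a := u ord_max; split=> [iu|[na /IHk iu']].
  split; last first.
    apply/IHk => H oH Hu; apply: (@inj_mwiden _ E); rewrite mwiden0.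
    apply: iu; first exact: overm_mwiden.
    by rewrite meval_muni muni_mwiden map_polyC hornerC.
  case=> p [p0 gp pa].
  have /choice[nd hnd] i : exists nd : {mpoly E[k]} * {mpoly E[k]},
      [/\ overm S nd.1, overm S nd.2, nd.2.@[u'] != 0 & p`_i = nd.1.@[u'] / nd.2.@[u']].
    by have [v [w h]] := adjoins_fraction (gp i); exists (v, w).
  pose n := size p; pose q i := (nd i).1 * \prod_(j < n | j != i :> nat) (nd j).2.
  pose d := \prod_(j < n) (nd j).2.@[u'].
  have oq i : overm S (q i).
    by apply: overmM; [have [] := hnd i|apply: overm_prod => j _; have [] := hnd j].
  have qb i : (i < n)%N -> (q i).@[u'] = p`_i * d.
    move=> ni; have [_ _ d0 ->] := hnd i.
    rewrite /d (bigD1 (Ordinal ni)) //= mulrA divfK // mevalM rmorph_prod.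
    by congr (_ * _); apply: eq_bigl => j.
  have d0 : d != 0 by apply/prodf_neq0 => j _; have [] := hnd j.
  pose H := \sum_(i < n) mwiden (q i) * 'X_ord_max ^+ i.
  have mH : muni H = \poly_(i < n) q i.
    rewrite poly_def rmorph_sum; apply: eq_bigr => i _.
    by rewrite rmorphM rmorphXn /= muni_mwiden muni_Xmax mul_polyC.
  have H0 : H = 0.
    apply: iu.
      apply: overm_sum => i _; apply: overmM; first exact: overm_mwiden.
      by rewrite mpolyXn; apply: overmX.
    rewrite meval_muni mH -/u' -/a; transitivity (d * p.[a]); last first.
      by rewrite (rootP pa) mulr0.
    rewrite (@horner_coef_wide _ n); last first.
      by rewrite (leq_trans (size_poly _ _)) ?size_poly.
    rewrite horner_coef mulr_sumr; apply: eq_bigr => i _.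
    by rewrite coef_map coef_poly ltn_ord /= qb // mulrA [d * _]mulrC.
  case/eqP: p0; apply/polyP => i; rewrite coef0.
  have [ni|/leq_sizeP -> //] := ltnP i n; apply/(mulIf d0).
  have /polyP/(_ i) : muni H = 0 by rewrite H0 muni0.
  by rewrite mH coef_poly ni coef0 -qb // => ->; rewrite meval0 mul0r.
move=> H oH Hu; have mH i : (map_poly (meval u') (muni H))`_i = ((muni H)`_i).@[u'].
  by rewrite coef_map.
have [q0|q0] := eqVneq (map_poly (meval u') (muni H)) 0; last first.
  case: na; exists (map_poly (meval u') (muni H)); split=> // [i|].
    by rewrite mH; apply/field_gen_meval/overm_muni.
  by rewrite /root -meval_muni Hu.
apply/mpolyP => m; rewrite -mcoeff_muni mcoeff0.
suff -> : (muni H)`_(m ord_max) = 0 by rewrite mcoeff0.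
by apply: iu'; [exact: overm_muni|rewrite -mH q0 coef0].
Qed.

End AlgebraicIndependence.

(** * Chains of irreducible closed sets *)

Local Notation wid := (widen_ord (leqnSn _)).

Section Irreducible.
Variables (K : fieldType) (N : nat).
Implicit Types (Z : point K N -> Prop) (P : {mpoly K[N]} -> Prop).

Lemma vanishing_ideal_ideal Z : is_ideal (vanishing_ideal Z).
Proof.
split=> [z _|f g vf vg z Zz|f g vg z Zz]; first by rewrite meval0.
  by rewrite mevalD vf ?vg ?addr0.
by rewrite mevalM vg ?mulr0.
Qed.

Lemma zero_set_closed (S : {mpoly K[N]} -> Prop) : zariski_closed (zero_set S).
Proof. by exists S. Qed.

Lemma closed_zero_set Z z : zariski_closed Z ->
  zero_set (vanishing_ideal Z) z -> Z z.
Proof.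
by move=> [S ZS] vz; apply/ZS => f Sf; apply: vz => y /ZS; apply.
Qed.

Lemma irreducible_prime Z : irreducible_closed Z ->
  is_prime_ideal (vanishing_ideal Z).
Proof.
move=> [cZ [z0 Zz0] irr]; split; first exact: vanishing_ideal_ideal.
  by move=> /(_ z0 Zz0) /eqP; rewrite meval1 oner_eq0.
move=> f g vfg.
have cl (h : {mpoly K[N]}) : zariski_closed (fun z => h.@[z] = 0).
  by exists (fun h' => h' = h) => z; split=> [hz _ ->|/(_ h)]; last exact.
case: (irr _ _ (cl f) (cl g)); [|by left|by right].
move=> z Zz; have /eqP := vfg z Zz; rewrite mevalM mulf_eq0.
by case/orP => /eqP; [left|right].
Qed.

End Irreducible.

(** * Coordinates independent modulo an ideal *)

Section IndependentCoordinates.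
Variables (K : fieldType) (N : nat).

Definition subst k (h : 'I_k -> {mpoly K[N]}) : {mpoly K[k]} -> {mpoly K[N]} :=
  mmap (@mpolyC N K) h.
HB.instance Definition _ k (h : 'I_k -> {mpoly K[N]}) :=
  GRing.RMorphism.copy (subst h) (mmap (@mpolyC N K) h).

Definition coords k (s : 'I_k -> 'I_N) : {mpoly K[k]} -> {mpoly K[N]} :=
  subst (fun i => 'X_(s i)).
HB.instance Definition _ k (s : 'I_k -> 'I_N) :=
  GRing.RMorphism.copy (coords s) (subst (fun i => 'X_(s i))).

(** Only coordinate functions are tested; this suffices to measure dimension because they generate
    the function field. *)
Definition indep_mod (J : {mpoly K[N]} -> Prop) k (s : 'I_k -> 'I_N) :=
  forall H, J (coords s H) -> H = 0.

Definition extend_last (T : Type) k (s : 'I_k -> T) (a : T) : 'I_k.+1 -> T :=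
  fun i => oapp s a (unlift ord_max i).

Lemma extend_last_max T k (s : 'I_k -> T) a : extend_last s a ord_max = a.
Proof. by rewrite /extend_last unlift_none. Qed.

Lemma extend_last_wid T k (s : 'I_k -> T) a i : extend_last s a (wid i) = s i.
Proof.
have -> : wid i = lift ord_max i.
  by apply: val_inj; rewrite /= /bump leqNgt ltn_ord.
by rewrite /extend_last liftK.
Qed.

Lemma indep_mod_sub J J' k (s : 'I_k -> 'I_N) : incl J J' ->
  indep_mod J' s -> indep_mod J s.
Proof. by move=> JJ' iJ' H /JJ' /iJ'. Qed.

Lemma coords_muni k (s : 'I_k.+1 -> 'I_N) (H : {mpoly K[k.+1]}) :
  coords s H = (map_poly (coords (fun i => s (wid i))) (muni H)).['X_(s ord_max)].
Proof. exact: mmap_muni. Qed.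

Lemma coordsC k (s : 'I_k -> 'I_N) c : coords s c%:MP = c%:MP.
Proof. exact: mmapC. Qed.

Lemma coordsX k (s : 'I_k -> 'I_N) i : coords s 'X_i = 'X_(s i).
Proof. by rewrite /coords /subst mmapX mmap1U. Qed.

Lemma subst_muni k (h : 'I_k.+1 -> {mpoly K[N]}) (H : {mpoly K[k.+1]}) :
  subst h H = (map_poly (subst (fun i => h (wid i))) (muni H)).[h ord_max].
Proof. exact: mmap_muni. Qed.

Lemma coords_extend_muni k (s : 'I_k -> 'I_N) f (H : {mpoly K[k.+1]}) :
  subst (extend_last (fun i => 'X_(s i)) f) H = (map_poly (coords s) (muni H)).[f].
Proof.
pose h : 'I_k.+1 -> {mpoly K[N]} := extend_last (fun i => 'X_(s i)) f.
have hw : (fun i => h (wid i)) = (fun i => 'X_(s i)).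
  by apply/funext => i; apply: extend_last_wid.
have hm : h ord_max = f by apply: extend_last_max.
by have := subst_muni h H; rewrite hw hm.
Qed.

(** The combination of [dependent_shift] as a polynomial in the coordinates, for [h] the last
    coordinate and [H j] in the others. It is nonzero by the univariate argument applied to
    [muni]. *)
Definition lagrange_mpoly k n (c l : 'I_n -> K) (H : 'I_n -> {mpoly K[k]}) :
    {mpoly K[k.+1]} :=
  \sum_j l j *: (mwiden (H j) * \prod_(i | i != j) ('X_ord_max - (c i)%:MP)).

Lemma muni_lagrange k n (c l : 'I_n -> K) (H : 'I_n -> {mpoly K[k]}) :
  muni (lagrange_mpoly c l H) =
  lagrange_poly (fun i => (c i)%:MP) (fun i => (l i)%:MP * H i).
Proof.
rewrite /lagrange_mpoly raddf_sum; apply: eq_bigr => i _.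
rewrite [LHS]muniZ muniM muni_mwiden rmorph_prod -scalerA -mul_polyC.
rewrite mul_polyC mul_polyC; congr (_ *: (_ *: _)).
by apply: eq_bigr => i' _; rewrite [LHS]muniB muni_Xmax muniC.
Qed.

Lemma coords_lagrange k n (c l : 'I_n -> K) (H : 'I_n -> {mpoly K[k]})
    (s : 'I_k.+1 -> 'I_N) :
  coords s (lagrange_mpoly c l H) =
  \sum_j l j *: (coords (fun i => s (wid i)) (H j) *
     \prod_(i | i != j) ('X_(s ord_max) - (c i)%:MP)).
Proof.
rewrite coords_muni muni_lagrange raddf_sum horner_sum; apply: eq_bigr => i _.
rewrite /= map_polyZ hornerZ /= rmorphM /= coordsC -mulrA mul_mpolyC.
congr (_ *: (_ * _)).
rewrite rmorph_prod horner_prod; apply: eq_bigr => i' _.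
by rewrite rmorphB /= map_polyX map_polyC hornerXsubC; congr (_ - _); apply: coordsC.
Qed.

Lemma lagrange_mpoly_neq0 k n (c l : 'I_n -> K) (H : 'I_n -> {mpoly K[k]}) j :
  injective c -> l j != 0 -> H j != 0 -> lagrange_mpoly c l H != 0.
Proof.
move=> cinj lj Hj; apply/eqP => G0; have := muni_lagrange c l H.
rewrite G0 muni0 => /esym/eqP; apply/negP/lagrange_poly_neq0.
  by move=> i i' /eqP; rewrite -subr_eq0 -mpolyCB mpolyC_eq0 subr_eq0 => /eqP/cinj.
by exists j; rewrite mulf_neq0 // mpolyC_eq0.
Qed.

Lemma coords_Xmax_sub k (s : 'I_k.+1 -> 'I_N) c :
  coords s ('X_ord_max - c%:MP) = 'X_(s ord_max) - c%:MP.
Proof. by rewrite rmorphB [X in X - _]coordsX [X in _ - X]coordsC. Qed.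

Lemma Xmax_sub_neq0 k (c : K) : 'X_ord_max - c%:MP != 0 :> {mpoly K[k.+1]}.
Proof.
apply/eqP => /(congr1 (@muni _ _)); rewrite muniB muni_Xmax muniC muni0.
by move/eqP; rewrite polyXsubC_eq0.
Qed.

End IndependentCoordinates.

Section FunctionFieldIndependence.
Variables (K E : fieldType) (N : nat) (phi : {rmorphism {mpoly K[N]} -> E}).

Definition scalars : E -> Prop := fun x => exists c : K, x = phi c%:MP.

Lemma field_gen_scalars x : field_gen scalars x -> scalars x.
Proof.
elim=> {x} [//||_ _ _ [c ->] _ [d ->]|_ _ _ [c ->] _ [d ->]|_ _ [c ->]].
- by exists 1; rewrite mpolyC1 rmorph1.
- by exists (c - d); rewrite mpolyCB rmorphB.
- by exists (c * d); rewrite mpolyCM rmorphM.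
- exists c^-1; have [->|c0] := eqVneq c 0; first by rewrite invr0 mpolyC0 rmorph0 invr0.
  have e : phi c%:MP * phi (c^-1)%:MP = 1.
    by rewrite -rmorphM -mpolyCM mulfV // mpolyC1 rmorph1.
  have pc0 : phi c%:MP != 0.
    by apply: contra_eq_neq e => ->; rewrite mul0r eq_sym oner_eq0.
  by apply: (mulfI pc0); rewrite e divff.
Qed.

Definition scalar_map : {rmorphism K -> E} := [the {rmorphism _ -> _} of phi \o @mpolyC N K].

Lemma mmap_scalar_map k (u : 'I_k -> E) (H : {mpoly K[k]}) :
  mmap scalar_map u H = (map_mpoly scalar_map H).@[u].
Proof.
rewrite (map_mpolyE scalar_map (leqnn _)) (mmapE _ (leqnn _)) raddf_sum /=.
by apply: eq_bigr => m _; rewrite mevalZ mevalX.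
Qed.

Lemma aindep_scalars k (u : 'I_k -> E) :
  aindep scalars u <-> forall H : {mpoly K[k]}, mmap scalar_map u H = 0 -> H = 0.
Proof.
split=> [iu H|iu H oH].
  rewrite mmap_scalar_map => /iu H0; apply/mpolyP => m; apply/(fmorph_inj scalar_map).
  rewrite -mcoeff_map_mpoly H0 ?mcoeff0 ?rmorph0 // => n.
  by rewrite mcoeff_map_mpoly; apply: field_gen_in; exists H@_n.
have /choice[c hc] m : exists c, H@_m = scalar_map c by apply/field_gen_scalars/oH.
pose H' : {mpoly K[k]} := \sum_(m : 'X_{1..k < msize H}) c m *: 'X_[m].
have HE : H = map_mpoly scalar_map H'.
  rewrite [LHS](mpolywE (leqnn _)) raddf_sum; apply: eq_bigr => m _.
  by rewrite /= map_mpolyZ map_mpolyX hc.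
by rewrite HE -mmap_scalar_map => /iu ->; rewrite raddf0.
Qed.

Lemma morph_subst k (h : 'I_k -> {mpoly K[N]}) H :
  phi (subst h H) = mmap scalar_map (fun i => phi (h i)) H.
Proof.
rewrite /subst !(mmapE _ (leqnn _)) raddf_sum; apply: eq_bigr => m _.
rewrite /= rmorphM /= rmorph_prod; congr (_ * _); apply: eq_bigr => i _.
exact: rmorphXn.
Qed.

Lemma acl_generators (S : E -> Prop) : (forall x, scalars x -> acl S x) ->
  (forall i, acl S (phi 'X_i)) -> forall f, acl S (phi f).
Proof.
move=> aS aX f; rewrite [f]mpolyE raddf_sum.
apply: (big_ind (acl S)) => [||m _]; [exact: acl0|exact: aclD|].
rewrite /= -mul_mpolyC rmorphM /=; apply: aclM; first by apply: aS; exists f@_m.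
rewrite mpolyXE_id rmorph_prod /=; apply: (big_ind (acl S)) => [||i _].
- exact: acl1.
- exact: aclM.
- rewrite rmorphXn; elim: (m i) => [|n IHn]; first exact: acl1.
  by rewrite exprS; apply: aclM.
Qed.

Lemma aindep_extend (S : E -> Prop) k (s : 'I_k -> 'I_N) j :
  aindep S (fun i => phi 'X_(s i)) ->
  ~ acl (adjoins S (olist (fun i => phi 'X_(s i)))) (phi 'X_j) ->
  aindep S (fun i => phi 'X_(extend_last s j i)).
Proof.
move=> iu nj; apply/aindep_lindep => /=; rewrite extend_last_max.
rewrite (_ : (fun i : 'I_k => _) = (fun i => phi 'X_(s i))); last first.
  by apply/funext => i; rewrite extend_last_wid.
by split=> //; apply/aindep_lindep.
Qed.

Hypothesis phi_frac : forall x, exists f g, phi g != 0 /\ x = phi f / phi g.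

Lemma acl_generators_all (S : E -> Prop) : (forall x, scalars x -> acl S x) ->
  (forall i, acl S (phi 'X_i)) -> forall x, acl S x.
Proof.
move=> aS aX x; have [f [g [_ ->]]] := phi_frac x.
by apply: aclM; [|apply: aclV]; apply: acl_generators.
Qed.

Variable P : {mpoly K[N]} -> Prop.
Hypothesis phi0 : forall f, phi f = 0 <-> P f.

Lemma indep_mod_aindep k (s : 'I_k -> 'I_N) :
  indep_mod P s <-> aindep scalars (fun i => phi 'X_(s i)).
Proof.
rewrite aindep_scalars; split=> iP H.
  by rewrite -morph_subst phi0 => /iP.
by move=> /phi0; rewrite morph_subst => /iP.
Qed.

End FunctionFieldIndependence.

Section ChainDimension.
Variables (K : closedFieldType) (N : nat).
Hypothesis Kunc : uncountable K.
Implicit Types (J P : {mpoly K[N]} -> Prop) (Z : point K N -> Prop).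

Lemma zero_set_irreducible P : is_prime_ideal P -> irreducible_closed (zero_set P).
Proof.
move=> pP; have [iP P1 Pp] := pP; split; first exact: zero_set_closed.
  by have [z Pz _] := prime_point Kunc pP P1; exists z.
move=> Z1 Z2 [S1 ZS1] [S2 ZS2] sub; apply: contrapT => /not_orP [n1 n2].
have wit S Z : (forall z, Z z <-> zero_set S z) -> ~ incl (zero_set P) Z ->
    exists f, S f /\ ~ P f.
  move=> ZS nZ; apply: contrapT => nf; apply: nZ => z Pz; apply/ZS => f Sf.
  by apply: Pz; apply: contrapT => Pf; apply: nf; exists f.
have [f [Sf Pf]] := wit _ _ ZS1 n1; have [g [Sg Pg]] := wit _ _ ZS2 n2.
suff /Pp [] : P (f * g) by [].
apply: (prime_nullstellensatz Kunc pP) => z /sub [/ZS1|/ZS2] Sz.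
  by rewrite mevalM Sz ?mul0r.
by rewrite mevalM mulrC Sz ?mul0r.
Qed.

(* If [f] lies in [P2] but not in [P1], a relation between [f] and coordinates
   independent modulo [P2] would, after division by a power of [f], have a
   constant term in [P2]. *)
Lemma indep_mod_extend P1 P2 k (s : 'I_k -> 'I_N) :
  is_prime_ideal P1 -> is_prime_ideal P2 -> incl P1 P2 -> ~ incl P2 P1 ->
  indep_mod P2 s -> exists j, indep_mod P1 (extend_last s j).
Proof.
move=> pP1 [iP2 _ _] P12 nP21 is2.
have [f [P2f P1f]] : exists f, P2 f /\ ~ P1 f.
  apply: contrapT => nf; apply: nP21 => f P2f.
  by apply: contrapT => P1f; apply: nf; exists f.
have [E [phi [phi0 phi_frac]]] := function_field pP1.
have [iP1 _ P1p] := pP1.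
have rel (q : {poly {mpoly K[k]}}) : P1 (map_poly (coords s) q).[f] -> q = 0.
  elim/poly_ind: q => [//|q c IHq].
  rewrite rmorphD rmorphM /= map_polyX map_polyC hornerMXaddC => P1q.
  have c0 : c = 0.
    apply: is2; rewrite -(addrK ((map_poly (coords s) q).[f] * f) (coords s c)).
    rewrite addrC [coords s c + _]addrC; apply: idealD => //; last exact: P12.
    by rewrite -mulNr; apply: idealM.
  move: P1q; rewrite c0 [X in P1 (_ + X)](rmorph0 (coords s)) addr0 => /P1p [/IHq->|//].
  by rewrite mul0r polyC0 addr0.
have iu := (indep_mod_aindep phi0 s).1 (indep_mod_sub P12 is2).
pose u i := phi 'X_(s i).
have fu : aindep (scalars phi) (extend_last u (phi f)).
  apply/aindep_scalars => H H0; apply/muni_eq0/rel/phi0.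
  rewrite -coords_extend_muni morph_subst -[RHS]H0; congr mmap.
  by apply/funext => i; rewrite /extend_last; case: unlift.
have [nf _] : lindep (scalars phi) (phi f :: olist u).
  have /aindep_lindep /= := fu; rewrite extend_last_max.
  by congr (_ /\ _); rewrite (_ : (fun i => _) = u) //; apply/funext => i;
    rewrite extend_last_wid.
(* [f] is a polynomial in the coordinates, so it would be algebraic if all of them were. *)
have [j nj] : exists j, ~ acl (adjoins (scalars phi) (olist u)) (phi 'X_j).
  apply: contrapT => nj; apply: nf; apply: acl_generators => [x Sx|j].
    by apply: acl_in; left.
  by apply: contrapT => naj; apply: nj; exists j.
by exists j; apply/(indep_mod_aindep phi0)/aindep_extend.
Qed.

Lemma prime_avoiding_coords J k (s : 'I_k -> 'I_N) : is_ideal J -> indep_mod J s ->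
  exists P, [/\ is_prime_ideal P, incl J P & indep_mod P s].
Proof.
move=> iJ iJs.
have [||f [H [H0 ->]] /iJs //|P [pP JP nP]] :=
    @prime_avoiding K N J (fun f => exists H, H != 0 /\ f = coords s H) iJ.
- by exists 1; rewrite oner_eq0 rmorph1.
- move=> _ _ [H1 [h1 ->]] [H2 [h2 ->]]; exists (H1 * H2).
  by rewrite mulf_neq0 // rmorphM.
- by move/eqP: H0.
exists P; split=> // H PH; apply/eqP/negPn/negP => H0.
by apply: (nP (coords s H)) => //; exists H.
Qed.

(* [P'] contains [x - c], with [x] the last coordinate and [c] a constant: if no
   [c] worked, some finitely many of the [u_c] such that [u_c * (x - c)] depends
   only on the other coordinates would be linearly dependent, and clearing
   denominators would yield a relation among the coordinates. *)
Lemma indep_mod_descend P k (s : 'I_k.+1 -> 'I_N) :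
  is_prime_ideal P -> indep_mod P s ->
  exists P', [/\ is_prime_ideal P', incl P P', ~ incl P' P
    & indep_mod P' (fun i => s (wid i))].
Proof.
move=> pP iPs; have [iP _ _] := pP.
set s' := fun i => s (wid i); set x := 'X_(s ord_max) : {mpoly K[N]}.
have [c ic] : exists c, indep_mod (add_gen P (x - c%:MP)) s'.
  apply: contrapT => nc.
  have /choice[Hu hHu] c : exists Hu : {mpoly K[k]} * {mpoly K[N]},
      Hu.1 != 0 /\ P (coords s' Hu.1 - Hu.2 * (x - c%:MP)).
    apply: contrapT => nH; apply: nc; exists c => H [u PHu _].
    by apply/eqP/negPn/negP => H0; apply: nH; exists (H, u).
  have [n [c [l [_ [cinj [j lj] _ lu]]]]] :=
    dependent_subfamily Kunc (fun=> 0%N) (fun c => (Hu c).2).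
  have := dependent_shift iP lu (fun j => (hHu (c j)).2).
  rewrite -coords_lagrange => /iPs; apply/eqP.
  exact: lagrange_mpoly_neq0 cinj lj (hHu (c j)).1.
have iPc := add_gen_ideal (x - c%:MP) iP.
have [P' [pP' PP' iP']] := prime_avoiding_coords iPc ic.
exists P'; split=> //; first by move=> f Pf; apply/PP'/add_gen_sub.
move=> /(_ _ (PP' _ (add_gen_gen (x - c%:MP) iP))).
by rewrite -coords_Xmax_sub => /iPs; apply/eqP/Xmax_sub_neq0.
Qed.

(** Dropping the independent coordinates one at a time enlarges the prime ideal strictly; by the
    Nullstellensatz the zero sets shrink strictly. *)
Lemma indep_mod_chain P k (s : 'I_k -> 'I_N) : is_prime_ideal P -> indep_mod P s ->
  exists C : nat -> point K N -> Prop,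
    [/\ forall i, (i <= k)%N -> irreducible_closed (C i),
        forall i, (i < k)%N -> incl (C i) (C i.+1) /\ ~ incl (C i.+1) (C i)
      & C k = zero_set P].
Proof.
elim: k P s => [|k IHk] P s pP iPs.
  by exists (fun=> zero_set P); split=> // i _; apply: zero_set_irreducible.
have [P' [pP' PP' nPP' iP's]] := indep_mod_descend pP iPs.
have [C [Cirr Cinc Ck]] := IHk _ _ pP' iP's.
exists (fun i => if (i <= k)%N then C i else zero_set P); split.
- move=> i _; case: ifP => [/Cirr //|_]; exact: zero_set_irreducible.
- move=> i; rewrite ltnS => ik.
  have {ik}/orP [/eqP->|ik] : (i == k) || (i < k)%N by rewrite -leq_eqVlt.
    rewrite leqnn ltnn Ck; split; first by move=> z P'z f /PP' /P'z.
    move=> sub; apply: nPP' => f P'f; apply: (prime_nullstellensatz Kunc pP) => z.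
    by move/sub; apply.
  by rewrite (ltnW ik) ik; apply: Cinc.
- by rewrite ltnn.
Qed.

(** Dimension equals transcendence degree: going up a chain gains one independent coordinate per
    step, and coordinates independent modulo [J] stay so modulo some prime containing [J]. *)
Theorem has_chain_indep J k : is_ideal J ->
  has_chain (zero_set J) k <-> exists s : 'I_k -> 'I_N, indep_mod J s.
Proof.
move=> iJ; split=> [[C [Cirr Cinc CJ]]|[s iJs]]; last first.
  have [P [pP JP iPs]] := prime_avoiding_coords iJ iJs.
  have [C [Cirr Cinc Ck]] := indep_mod_chain pP iPs.
  by exists C; split=> //; rewrite Ck => z Pz f /JP /Pz.
suff /(_ k (leqnn k)) [s is_] : forall i, (i <= k)%N ->
    exists s : 'I_i -> 'I_N, indep_mod (vanishing_ideal (C i)) s.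
  exists s; apply: indep_mod_sub is_ => f Jf z /CJ; exact.
elim=> [|i IHi] ik.
  have [_ V1 _] := irreducible_prime (Cirr _ ik).
  have s : 'I_0 -> 'I_N by case.
  exists s => H; rewrite (nvar0_mpolyC H) coordsC => VH.
  have [->|H0] := eqVneq (H@_0%MM) 0; first by rewrite mpolyC0.
  case: V1; have := idealZ (H@_0%MM)^-1 (vanishing_ideal_ideal (C 0%N)) VH.
  by rewrite -mul_mpolyC -mpolyCM mulVf // mpolyC1.
have [s is_] := IHi (ltnW ik).
have [CC nCC] := Cinc _ ik.
have [||j ij] := indep_mod_extend (irreducible_prime (Cirr _ ik))
  (irreducible_prime (Cirr _ (ltnW ik))) _ _ is_.
- by move=> f vf z /CC; apply: vf.
- move=> sub; apply: nCC => z Cz; have [clC _ _] := Cirr _ (ltnW ik).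
  by apply: closed_zero_set => // f /sub; apply.
by exists (extend_last s j).
Qed.

End ChainDimension.

(** * Ideals of leaves *)

(** Used to replace the conditions imposed by infinitely many words by a finite matrix. *)
Lemma finite_spanning_subset (E : fieldType) m (Q : 'rV[E]_m -> Prop) :
  exists r (U : 'M[E]_(r, m)), (forall i, Q (row i U)) /\
    forall u, Q u -> (u <= U)%MS.
Proof.
apply: contrapT => nU.
have grow k : exists r (U : 'M[E]_(r, m)), (forall i, Q (row i U)) /\ (k <= \rank U)%N.
  elim: k => [|k [r [U [QU kU]]]]; first by exists 0%N, 0; split=> // -[].
  have [u [Qu uU]] : exists u, Q u /\ ~~ (u <= U)%MS.
    apply: contrapT => nu; apply: nU; exists r, U; split=> // u Qu.
    by apply/negPn/negP => uU; apply: nu; exists u.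
  exists (r + 1)%N, (col_mx U u); split.
    move=> i; have [j ->|j ->] := split_ordP i; first by rewrite rowKu.
    by rewrite rowKd (ord1 j) row_id.
  apply: leq_ltn_trans kU _.
  have UUu : (U <= col_mx U u)%MS by rewrite -addsmxE addsmxSl.
  have [le_r eq_r] := mxrank_leqif_sup UUu.
  by rewrite ltn_neqAle le_r andbT eq_r col_mx_sub submx_refl.
have [r [U [_]]] := grow m.+1.
by rewrite ltnNge rank_leq_col.
Qed.

Section Words.
Variables (K : fieldType) (N : nat) (X : point K N -> Prop).
Variable F : ({mpoly K[N]} -> {mpoly K[N]}) -> Prop.
Hypothesis FX : forall D, F D -> vector_field_on X D.
Implicit Types (f g : {mpoly K[N]}) (x : point K N).

Inductive word : ({mpoly K[N]} -> {mpoly K[N]}) -> Prop :=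
| word_id : word (fun f => f)
| word_comp D w : F D -> word w -> word (fun f => w (D f)).

Lemma word_left D w : F D -> word w -> word (fun f => D (w f)).
Proof.
move=> FD; elim=> [|D' w' FD' _ IH]; first exact: word_comp FD word_id.
exact: word_comp FD' IH.
Qed.

Lemma vf_add D f g : F D -> D (f + g) = D f + D g.
Proof. by move=> /FX [[]]. Qed.
Lemma vf_scale D c f : F D -> D (c *: f) = c *: D f.
Proof. by move=> /FX [[]]. Qed.
Lemma vf_mul D f g : F D -> D (f * g) = f * D g + D f * g.
Proof. by move=> /FX [[]]. Qed.
Lemma vf_ideal D f : F D -> vanishing_ideal X f -> vanishing_ideal X (D f).
Proof. by move=> /FX [_]; apply. Qed.

Lemma wordD w f g : word w -> w (f + g) = w f + w g.
Proof. by move=> ww; elim: ww f g => // D w' FD _ IH f g; rewrite vf_add // IH. Qed.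
Lemma wordZ w c f : word w -> w (c *: f) = c *: w f.
Proof. by move=> ww; elim: ww f => // D w' FD _ IH f; rewrite vf_scale // IH. Qed.
Lemma wordP w f : word w -> vanishing_ideal X f -> vanishing_ideal X (w f).
Proof. by move=> ww; elim: ww f => // D w' FD _ IH f Pf; apply/IH/vf_ideal. Qed.
Lemma word_sum w (I : Type) (r : seq I) (P : pred I) (G : I -> {mpoly K[N]}) :
  word w -> w (\sum_(i <- r | P i) G i) = \sum_(i <- r | P i) w (G i).
Proof.
move=> ww; have w0 : w 0 = 0 by rewrite -(scale0r 0) wordZ // !scale0r.
exact: (big_morph w (fun f g => wordD f g ww) w0).
Qed.

Definition wideal x f := forall w, word w -> (w f).@[x] = 0.

Lemma wideal_field x D f : F D -> wideal x f -> wideal x (D f).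
Proof. by move=> FD wf w ww; apply: (wf _ (word_comp FD ww)). Qed.

Lemma wideal_ideal x : is_ideal (wideal x).
Proof.
split=> [w ww|f g wf wg w ww|f g wg w ww].
- by rewrite -(scale0r (0 : {mpoly K[N]})) wordZ // scale0r meval0.
- by rewrite wordD // mevalD wf ?wg ?addr0.
- elim: ww f g wg => [|D w' FD ww' IH] f g wg.
    by rewrite mevalM (wg _ word_id) mulr0.
  rewrite vf_mul // wordD // mevalD !IH ?addr0 //.
  exact: wideal_field.
Qed.

Inductive word_of_length : nat -> ({mpoly K[N]} -> {mpoly K[N]}) -> Prop :=
| length_id : word_of_length 0 (fun f => f)
| length_comp n D w : F D -> word_of_length n w ->
    word_of_length n.+1 (fun f => w (D f)).

Lemma word_length w : word w <-> exists n, word_of_length n w.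
Proof.
split=> [|[n]]; first elim=> [|D w' FD _ [n nw]].
- by exists 0%N; constructor.
- by exists n.+1; constructor.
by elim=> [|m D w' FD _]; constructor.
Qed.

(* In the Leibniz expansion only the term with all derivations on [f] survives. *)
Lemma wordM_shorter x n w f g : word_of_length n w ->
  (forall k v, (k < n)%N -> word_of_length k v -> (v f).@[x] = 0) ->
  (w (f * g)).@[x] = (w f).@[x] * g.@[x].
Proof.
move=> nw; elim: nw f g => [|m D w' FD mw IH] f g short; first by rewrite mevalM.
have ww : word w' by apply/word_length; exists m.
rewrite vf_mul // wordD // mevalD IH; last by move=> k v km; apply: short (ltnW _).
rewrite (short _ _ (ltnSn m) mw) mul0r add0r IH // => k v km vk.
by apply: (short k.+1 (fun f => v (D f))) => //; constructor.
Qed.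

(** Induction on the length of the word: once shorter words kill [f] at [x], the Leibniz expansion
    leaves [w f] times [g] at [x]. This is what makes the poles of the rational map harmless. *)
Lemma wideal_cancel x f g : g.@[x] != 0 -> wideal x (f * g) -> wideal x f.
Proof.
move=> gx wfg w /word_length [n nw]; elim/ltn_ind: n w nw => n IH w nw.
have ww : word w by apply/word_length; exists n.
have /eqP := wfg w ww.
rewrite (wordM_shorter _ nw (fun k v kn kv => IH k kn v kv)).
by rewrite mulf_eq0 (negPf gx) orbF => /eqP.
Qed.

Lemma foliation_idealE x f : X x ->
  foliation_ideal X F (fun z => z = x) f <-> wideal x f.
Proof.
move=> Xx; split=> [[J [_ _ Jx JF Jf]] w ww|wf].
  suff : J (w f) by move=> /Jx /(_ x erefl).
  by elim: ww f Jf => // D w' FD _ IH f Jf; apply/IH/JF.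
exists (wideal x); split=> //; first exact: wideal_ideal.
- by move=> g Pg w ww; apply: (wordP ww Pg).
- by move=> g wg z ->; exact: (wg _ word_id).
- by move=> D FD g; apply: wideal_field.
Qed.

End Words.

(** * Constants of the function field *)

Section Constants.
Variables (K : fieldType) (N : nat) (X : point K N -> Prop).
Variable F : ({mpoly K[N]} -> {mpoly K[N]}) -> Prop.
Hypothesis FX : forall D, F D -> vector_field_on X D.
Variables (E : fieldType) (phi : {rmorphism {mpoly K[N]} -> E}).
Hypothesis phi0 : forall f, phi f = 0 <-> vanishing_ideal X f.
Hypothesis phi_frac : forall x, exists f g, phi g != 0 /\ x = phi f / phi g.
Implicit Types (f g : {mpoly K[N]}) (x y : E).

Definition extends (D : {mpoly K[N]} -> {mpoly K[N]}) (delta : E -> E) :=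
  [/\ {morph delta : x y / x + y},
      forall x y, delta (x * y) = x * delta y + delta x * y
    & forall f, delta (phi f) = phi (D f)].

Lemma exists_extension D : F D -> exists delta, extends D delta.
Proof.
move=> FD; apply: extend_derivation => //.
- by move=> f g; apply: (vf_add FX).
- by move=> f g; apply: (vf_mul FX).
- move=> f /phi0 Pf; apply/phi0. exact (vf_ideal FX FD Pf).
Qed.

Section Extension.
Variables (D : {mpoly K[N]} -> {mpoly K[N]}) (delta : E -> E).
Hypothesis eD : extends D delta.

Lemma delta_add x y : delta (x + y) = delta x + delta y.
Proof. by case: eD. Qed.
Lemma delta_mul x y : delta (x * y) = x * delta y + delta x * y.
Proof. by case: eD. Qed.
Lemma delta_phi f : delta (phi f) = phi (D f).
Proof. by case: eD. Qed.
Lemma delta0 : delta 0 = 0.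
Proof. by apply: (addrI (delta 0)); rewrite -delta_add !addr0. Qed.
Lemma delta1 : delta 1 = 0.
Proof.
by apply: (addrI (delta 1)); rewrite addr0 -[in RHS](mulr1 1) delta_mul mulr1 mul1r.
Qed.
Lemma delta_opp x : delta (- x) = - delta x.
Proof. by apply/eqP; rewrite -addr_eq0 -delta_add addNr delta0. Qed.
Lemma delta_inv x : delta x^-1 = - delta x / x ^+ 2.
Proof.
have [->|x0] := eqVneq x 0; first by rewrite invr0 delta0 oppr0 mul0r.
apply: (mulfI x0); have := delta_mul x x^-1.
rewrite divff // delta1 => /eqP; rewrite eq_sym addr_eq0 => /eqP ->.
by field.
Qed.
Lemma delta_sum (I : Type) (r : seq I) (P : pred I) (G : I -> E) :
  delta (\sum_(i <- r | P i) G i) = \sum_(i <- r | P i) delta (G i).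
Proof. exact: (big_morph delta delta_add delta0). Qed.

Lemma delta_frac f g : phi g != 0 ->
  delta (phi f / phi g) = phi (D f * g - f * D g) / phi g ^+ 2.
Proof.
move=> g0; rewrite delta_mul delta_inv !delta_phi rmorphB !rmorphM /=.
by field.
Qed.

End Extension.

(** Members of [F] act on polynomials only, so constancy is tested on their extensions to [E];
    [exists_extension] keeps the test from being vacuous. *)
Definition const e := forall D delta, F D -> extends D delta -> delta e = 0.

Lemma const_frac f g : phi g != 0 ->
  const (phi f / phi g) <->
  forall D, F D -> vanishing_ideal X (D f * g - f * D g).
Proof.
move=> g0; split=> [cfg D FD|h D delta FD eD]; last first.
  by rewrite (delta_frac eD) // (phi0 _).2 ?mul0r //; apply: h.
have [delta eD] := exists_extension FD; apply/phi0/eqP.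
have /eqP := cfg D delta FD eD; rewrite (delta_frac eD) // mulf_eq0.
by rewrite invr_eq0 expf_eq0 (negPf g0) orbF.
Qed.

Lemma const_scalars x : scalars phi x -> const x.
Proof.
move=> [c ->] D delta FD eD; have D1 : D 1 = 0.
  by apply: (addrI (D 1)); rewrite addr0 -[in RHS](mulr1 1) (vf_mul FX) // mulr1 mul1r.
by rewrite (delta_phi eD) -alg_mpolyC (vf_scale FX) // D1 scaler0 rmorph0.
Qed.

Lemma field_gen_const x : field_gen const x -> const x.
Proof.
elim=> {x} [//|D d FD eD|x y _ cx _ cy D d FD eD|x y _ cx _ cy D d FD eD|x _ cx D d FD eD].
- exact: delta1 eD.
- by rewrite (delta_add eD) (delta_opp eD) (cx D d FD eD) (cy D d FD eD) ?subr0.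
- by rewrite (delta_mul eD) (cx D d FD eD) (cy D d FD eD) ?mulr0 ?mul0r ?addr0.
- by rewrite (delta_inv eD) (cx D d FD eD) ?oppr0 ?mul0r.
Qed.

Section Kernel.
Variables (m : nat) (e : 'I_m -> {mpoly K[N]}).
Implicit Types (u v : 'rV[E]_m).

(* The coefficient vectors of the elements of I(F, x), for [x] the generic point
   of [X], that lie in the span of the family [e]. *)
Definition word_kernel v :=
  forall w, word F w -> \sum_i v 0 i * phi (w (e i)) = 0.

Lemma word_kernel_lin a u v : word_kernel u -> word_kernel v ->
  word_kernel (a *: u + v).
Proof.
move=> ku kv w ww; transitivity
    (a * (\sum_i u 0 i * phi (w (e i))) + \sum_i v 0 i * phi (w (e i))).
  rewrite mulr_sumr -big_split.
  by apply: eq_bigr => i _; rewrite /= !mxE mulrDl mulrA.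
by rewrite ku // kv // mulr0 addr0.
Qed.

(** Differentiating the relation for [w] yields the one for the differentiated entries plus the one
    for the word [D] after [w], and the latter vanishes. *)
Lemma word_kernel_delta D delta v : F D -> extends D delta ->
  word_kernel v -> word_kernel (\row_i delta (v 0 i)).
Proof.
move=> FD eD kv w ww; have := congr1 delta (kv w ww).
rewrite (delta0 eD) (delta_sum eD) => h.
have h' := kv _ (word_left FD ww).
rewrite -[RHS]subr0 -[X in _ = _ - X]h' -[X in _ = X - _]h -sumrB.
apply: eq_bigr => i _.
by rewrite mxE (delta_mul eD) (delta_phi eD) [X in _ = X - _]addrC addrK.
Qed.

(* A kernel vector of minimal support with an entry 1 is killed by every
   derivation, since the derivative has smaller support. *)
Lemma word_kernel_const v : word_kernel v -> v != 0 ->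
  exists u, [/\ word_kernel u, forall i, const (u 0 i),
    forall i, v 0 i = 0 -> u 0 i = 0 & exists2 i, v 0 i != 0 & u 0 i = 1].
Proof.
have [n] := ubnP #|[pred i | v 0 i != 0]|.
elim: n v => // n IHn v; rewrite ltnS => vn kv v0.
have [i vi] : exists i, v 0 i != 0.
  apply: contrapT => nv; case/eqP: v0; apply/rowP => i; rewrite mxE.
  by apply/eqP/negPn/negP => vi; apply: nv; exists i.
pose u := (v 0 i)^-1 *: v.
have ku : word_kernel u.
  rewrite -[u]addr0; apply: word_kernel_lin => // w _.
  by apply: big1 => j _; rewrite mxE mul0r.
have ui : u 0 i = 1 by rewrite mxE mulVf.
have uv j : v 0 j = 0 -> u 0 j = 0 by move=> vj; rewrite mxE vj mulr0.
have [cu|] := pselect (forall j, const (u 0 j)).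
  by exists u; split=> //; exists i.
move=> ncu; have [D [delta [FD eD [j duj]]]] : exists D delta,
    [/\ F D, extends D delta & exists j, delta (u 0 j) != 0].
  apply: contrapT => nD; apply: ncu => j D delta FD eD.
  apply/eqP/negPn/negP => duj; apply: nD; exists D, delta; split=> //.
  by exists j.
pose u' := \row_i delta (u 0 i).
have u'v a : v 0 a = 0 -> u' 0 a = 0.
  by move=> /uv ua; rewrite mxE ua (delta0 eD).
have u'i : u' 0 i = 0 by rewrite mxE ui (delta1 eD).
have [||t [kt ct tu' [a u'a ta]]] := IHn u' _ (word_kernel_delta FD eD ku).
- apply: leq_trans vn; apply: proper_card; apply/properP; split.
    by apply/subsetP => a; rewrite !inE; apply: contra_neq => /u'v.
  by exists i; rewrite !inE // u'i eqxx.
- by apply: contraNneq duj => /rowP/(_ j); rewrite !mxE => ->.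
exists t; split=> // [b /u'v /tu' //|]; exists a => //.
by apply: contra_neq u'a => /u'v.
Qed.

(** Subtracting from [v] a multiple of a constant kernel vector supported inside [v] removes an
    entry; induction on the size of the support. *)
Lemma word_kernel_span : exists r (U : 'M[E]_(r, m)),
  (forall j, word_kernel (row j U) /\ forall i, const (U j i)) /\
  forall v, word_kernel v -> (v <= U)%MS.
Proof.
have [r [U [kU sU]]] := finite_spanning_subset
  (fun u : 'rV[E]_m => word_kernel u /\ forall i, const (u 0 i)).
exists r, U; split=> [j|v kv].
  by have [kj cj] := kU j; split=> // i; have := cj i; rewrite mxE.
have [n] := ubnP #|[pred i | v 0 i != 0]|.
elim: n v kv => // n IHn v kv; rewrite ltnS => vn.
have [->|v0] := eqVneq v 0; first exact: sub0mx.
have [u [ku cu uv [i vi ui]]] := word_kernel_const kv v0.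
have -> : v = v 0 i *: u + (- v 0 i *: u + v) by rewrite addrA -scalerDl subrr scale0r add0r.
apply: addmx_sub; first by apply: scalemx_sub; apply: sU.
apply: IHn; first exact: word_kernel_lin.
apply: leq_trans vn; apply: proper_card; apply/properP; split.
  apply/subsetP => a; rewrite !inE; apply: contra_neq => va.
  by rewrite !mxE va uv // mulr0 addr0.
by exists i; rewrite !inE // !mxE ui mulr1 addNr eqxx.
Qed.

(** A derivation applied to a relation over the constants only differentiates the [e i]. *)
Lemma const_relation_word (v : 'rV[E]_m) : (forall i, const (v 0 i)) ->
  \sum_i v 0 i * phi (e i) = 0 -> word_kernel v.
Proof.
move=> cv ve w ww; elim: ww (e) ve => // D w' FD _ IH f vf.
apply: IH; have [delta eD] := exists_extension FD.
have := congr1 delta vf; rewrite (delta0 eD) (delta_sum eD) => h.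
rewrite -[RHS]h; apply: eq_bigr => i _.
by rewrite (delta_mul eD) (delta_phi eD) (cv i D delta FD eD) mul0r addr0.
Qed.

End Kernel.

End Constants.

(** * Specialization at points *)

Section Specialization.
Variables (K : fieldType) (N : nat) (X : point K N -> Prop).
Variables (E : fieldType) (phi : {rmorphism {mpoly K[N]} -> E}).
Hypothesis phi0 : forall f, phi f = 0 <-> vanishing_ideal X f.
Hypothesis phi_frac : forall x, exists f g, phi g != 0 /\ x = phi f / phi g.
Implicit Types (f g : {mpoly K[N]}) (x : point K N) (e : E).

Lemma phi_neq0 x f : X x -> f.@[x] != 0 -> phi f != 0.
Proof. by move=> Xx; apply: contra_neq => /phi0 /(_ x Xx). Qed.

(** Membership of [e] in the local ring at [x] together with its value, kept as a relation so that
    sums and products need no separate proof of regularity. *)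
Definition has_value x e (c : K) := exists f g,
  [/\ g.@[x] != 0, e = phi f / phi g & c = f.@[x] / g.@[x]].

Definition regular x e := exists c, has_value x e c.

(* The value is [0] where [e] is not regular. *)
Definition spec x e : K :=
  if pselect (regular x e) is left h then projT1 (cid h) else 0.

Lemma regular_spec x e : regular x e -> has_value x e (spec x e).
Proof.
by rewrite /spec; case: pselect => // h _; exact: projT2 (cid h).
Qed.

Lemma has_value_unique x e c c' : X x ->
  has_value x e c -> has_value x e c' -> c = c'.
Proof.
move=> Xx [f [g [gx -> ->]]] [f' [g' [gx' e' ->]]].
have g0 := phi_neq0 Xx gx; have g0' := phi_neq0 Xx gx'.
have : phi (f * g' - f' * g) = 0.
  apply/eqP; rewrite rmorphB !rmorphM subr_eq0 -eqr_div //.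
  exact/eqP.
move=> /phi0 /(_ x Xx) /eqP; rewrite mevalB !mevalM subr_eq0 => fg.
by apply/eqP; rewrite eqr_div.
Qed.

Lemma value_spec x e c : X x -> has_value x e c -> spec x e = c.
Proof.
move=> Xx vc; apply: (has_value_unique Xx _ vc); apply: regular_spec.
by exists c.
Qed.

Lemma value_phi x f : has_value x (phi f) f.@[x].
Proof. by exists f, 1; rewrite meval1 rmorph1 !divr1 oner_eq0. Qed.

Lemma value_add x e e' c c' : X x -> has_value x e c -> has_value x e' c' ->
  has_value x (e + e') (c + c').
Proof.
move=> Xx [f [g [gx -> ->]]] [f' [g' [gx' -> ->]]].
have g0 := phi_neq0 Xx gx; have g0' := phi_neq0 Xx gx'.
exists (f * g' + f' * g), (g * g').
by rewrite mevalM mulf_neq0 // !addf_div // mevalD !mevalM rmorphD !rmorphM.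
Qed.

Lemma value_mul x e e' c c' : has_value x e c -> has_value x e' c' ->
  has_value x (e * e') (c * c').
Proof.
move=> [f [g [gx -> ->]]] [f' [g' [gx' -> ->]]].
exists (f * f'), (g * g').
by rewrite !mevalM mulf_neq0 // !rmorphM !mulf_div.
Qed.

Lemma value0 x : has_value x 0 0.
Proof. by rewrite -(rmorph0 phi) -[X in has_value _ _ X](meval0 x); apply: value_phi. Qed.

Lemma value1 x : has_value x 1 1.
Proof. by rewrite -(rmorph1 phi) -[X in has_value _ _ X](meval1 x); apply: value_phi. Qed.

Lemma value_sum x (I : Type) (r : seq I) (P : pred I) (G : I -> E) (h : I -> K) :
  X x -> (forall i, P i -> has_value x (G i) (h i)) ->
  has_value x (\sum_(i <- r | P i) G i) (\sum_(i <- r | P i) h i).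
Proof.
move=> Xx hG; apply: (big_ind2 (has_value x)) => //; first exact: value0.
by move=> *; apply: value_add.
Qed.

Definition generically (Q : point K N -> Prop) :=
  exists b, ~ vanishing_ideal X b /\ forall x, X x -> b.@[x] != 0 -> Q x.

Lemma generically_mono (Q Q' : point K N -> Prop) :
  (forall x, X x -> Q x -> Q' x) -> generically Q -> generically Q'.
Proof. by move=> QQ' [b [Pb bQ]]; exists b; split=> // x Xx /(bQ x Xx) /(QQ' x Xx). Qed.

Lemma generically_regular e : generically (fun x => regular x e).
Proof.
have [f [g [g0 ->]]] := phi_frac e; exists g; split=> [/phi0 gz|x Xx gx].
  by rewrite gz eqxx in g0.
by exists (f.@[x] / g.@[x]), f, g.
Qed.

Lemma generically_all (T : finType) (Q : T -> point K N -> Prop) :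
  (forall i, generically (Q i)) -> generically (fun x => forall i, Q i x).
Proof.
move=> /choice [b hb]; exists (\prod_i b i); split=> [/phi0|x Xx bx i].
  rewrite rmorph_prod => /eqP /prodf_eq0 [i _ /eqP/phi0].
  by have [] := hb i.
have [_] := hb i; apply=> //; apply: contraNneq bx => bi.
by rewrite rmorph_prod /= (bigD1 i) //= bi mul0r.
Qed.

Lemma generically_and (Q Q' : point K N -> Prop) :
  generically Q -> generically Q' -> generically (fun x => Q x /\ Q' x).
Proof.
move=> gQ gQ'; have : generically (fun x => forall b : bool, if b then Q x else Q' x).
  by apply: generically_all; case.
by apply: generically_mono => x _ h; split; [apply: (h true)|apply: (h false)].
Qed.

Definition very_generically (Q : point K N -> Prop) :=
  exists b : nat -> {mpoly K[N]}, (forall i, ~ vanishing_ideal X (b i)) /\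
    forall x, X x -> (forall i, (b i).@[x] != 0) -> Q x.

Lemma very_generically_all (Q : nat -> point K N -> Prop) :
  (forall d, generically (Q d)) -> very_generically (fun x => forall d, Q d x).
Proof.
move=> /choice [b hb]; exists b; split=> [i|x Xx bx d]; first by have [] := hb i.
by have [_] := hb d; apply.
Qed.

Lemma very_generically_generic Q : generically Q -> very_generically Q.
Proof. by move=> [b [Pb bQ]]; exists (fun=> b); split=> // x Xx /(_ 0%N); apply: bQ. Qed.

Lemma very_generically_mono (Q Q' : point K N -> Prop) :
  (forall x, X x -> Q x -> Q' x) -> very_generically Q -> very_generically Q'.
Proof. by move=> QQ' [b [Pb bQ]]; exists b; split=> // x Xx /(bQ x Xx) /(QQ' x Xx). Qed.

Lemma very_generically_and (Q Q' : point K N -> Prop) :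
  very_generically Q -> very_generically Q' ->
  very_generically (fun x => Q x /\ Q' x).
Proof.
move=> [b [Pb bQ]] [b' [Pb' bQ']].
exists (fun i => if odd i then b i./2 else b' i./2); split.
  by move=> i; case: ifP.
move=> x Xx bx; split; [apply: bQ|apply: bQ'] => // i.
  by have := bx i.*2.+1; rewrite /= odd_double uphalf_double.
by have := bx i.*2; rewrite odd_double doubleK.
Qed.

End Specialization.

Section KernelSpecialization.
Variables (K : fieldType) (N : nat) (X : point K N -> Prop).
Variable F : ({mpoly K[N]} -> {mpoly K[N]}) -> Prop.
Hypothesis FX : forall D, F D -> vector_field_on X D.
Variables (E : fieldType) (phi : {rmorphism {mpoly K[N]} -> E}).
Hypothesis phi0 : forall f, phi f = 0 <-> vanishing_ideal X f.
Hypothesis phi_frac : forall x, exists f g, phi g != 0 /\ x = phi f / phi g.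
Implicit Types (f g : {mpoly K[N]}) (x : point K N).

Local Notation spec := (spec phi).
Local Notation regular := (regular phi).

Section Family.
Variables (m : nat) (e : 'I_m -> {mpoly K[N]}).

Definition point_kernel x (c : 'rV[K]_m) :=
  forall w, word F w -> \sum_i c 0 i * (w (e i)).@[x] = 0.

(** A matrix identity over [E] expresses the identity through the word matrix and [U]. Evaluated at
    a point where all its entries are regular and applied to a vector of the kernel there, it loses
    the word term and leaves a combination of the rows of [U]. *)
Lemma kernel_specialization : exists r (U : 'M[E]_(r, m)),
  [/\ forall j, word_kernel F phi e (row j U), forall j i, const F phi (U j i)
    & generically X (fun x => (forall j i, regular x (U j i)) /\
        forall c, point_kernel x c -> (c <= map_mx (spec x) U)%MS)].
Proof.
have [r [U [kcU sU]]] := word_kernel_span F phi e.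
have [t [A [wA sA]]] := finite_spanning_subset
  (fun u : 'rV[E]_m => exists w, word F w /\ forall i, u 0 i = phi (w (e i))).
have /choice[w hw] := wA.
exists r, U; split=> [j|j i|]; [by have [] := kcU j|by have [] := kcU j|].
have kA (v : 'rV[E]_m) : v *m A^T = 0 -> word_kernel F phi e v.
  move=> vA w' ww'; pose u : 'rV[E]_m := \row_i phi (w' (e i)).
  have /sA /submxP [c uc] : exists w, word F w /\ forall i, u 0 i = phi (w (e i)).
    by exists w'; split=> // i; rewrite mxE.
  have : v *m u^T = 0 by rewrite uc trmx_mul mulmxA vA mul0mx.
  move=> /matrixP/(_ 0 0); rewrite !mxE => h; rewrite -[RHS]h.
  by apply: eq_bigr => i _; rewrite !mxE.
(* With [G] a pseudo-inverse of [A^T], the rows of [1 - A^T G] are killed by [A^T], so they lie in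
   the span of [U]. *)
have [G [B id1]] : exists (G : 'M_(t, m)) (B : 'M_(m, r)),
    1%:M = A^T *m G + B *m U.
  exists (pinvmx A^T); set G := pinvmx _.
  have : (1%:M - A^T *m G <= U)%MS.
    apply/row_subP => i; apply/sU/kA; rewrite -row_mul mulmxBl mul1mx.
    by rewrite mulmxKpV ?subrr ?row0.
  by move=> /submxP [B BU]; exists B; rewrite -BU addrC subrK.
have reg a b (M : 'M[E]_(a, b)) :
    generically X (fun x => forall ij, regular x (M ij.1 ij.2)).
  by apply: generically_all => // ij; apply: generically_regular.
have := generically_and phi0 (reg _ _ U) (generically_and phi0 (reg _ _ G) (reg _ _ B)).
apply: generically_mono => x Xx [rU [rG rB]]; split=> [j i|c kc].
  exact: (rU (j, i)).
pose Ax : 'M[K]_(m, t) := \matrix_(i, k) (w k (e i)).@[x].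
have idx : 1%:M = Ax *m map_mx (spec x) G + map_mx (spec x) B *m map_mx (spec x) U.
  apply/matrixP => i j; apply: (has_value_unique phi0 Xx (e := (1%:M : 'M[E]_m) i j)).
    by rewrite !mxE; case: (i == j); [exact: value1|exact: value0].
  rewrite id1 !mxE; apply: (value_add phi0 Xx); apply: (value_sum phi0) => // k _.
    rewrite !mxE; apply: value_mul; last exact: regular_spec (rG (k, j)).
    have [_ /(_ i)] := hw k; rewrite mxE => ->; exact: value_phi.
  by rewrite !mxE; apply: value_mul; apply: regular_spec;
    [exact: (rB (i, k))|exact: (rU (k, j))].
rewrite -[c]mulmx1 idx mulmxDr !mulmxA.
have -> : c *m Ax = 0.
  apply/rowP => k; rewrite !mxE; have [wk _] := hw k.
  by rewrite -[RHS](kc _ wk); apply: eq_bigr => i _; rewrite !mxE.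
by rewrite mul0mx add0r submxMl.
Qed.

(** A trivial kernel at [x] means a maximal minor of the word matrix that is nonzero at [x]; that
    minor is then nonzero in [E]. *)
Lemma kernel_semicontinuity x : X x ->
  (forall c, point_kernel x c -> c = 0) ->
  forall v, word_kernel F phi e v -> v = 0.
Proof.
move=> Xx kx v kv.
have [r [U [wU sU]]] := finite_spanning_subset
  (fun u : 'rV[K]_m => exists w, word F w /\ forall i, u 0 i = (w (e i)).@[x]).
have /choice[w hw] := wU.
have fullU : row_full U.
  rewrite /row_full -mxrank_tr -/(row_free U^T) -kermx_eq0.
  apply/negPn/negP => /rowV0Pn [c /sub_kermxP cU]; apply/negP/negPn/eqP/kx.
  move=> w' ww'; pose u : 'rV[K]_m := \row_i (w' (e i)).@[x].
  have /sU /submxP [d ud] : exists w, word F w /\ forall i, u 0 i = (w (e i)).@[x].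
    by exists w'; split=> // i; rewrite mxE.
  have : c *m u^T = 0 by rewrite ud trmx_mul mulmxA cU mul0mx.
  move=> /matrixP/(_ 0 0); rewrite !mxE => h; rewrite -[RHS]h.
  by apply: eq_bigr => i _; rewrite !mxE.
pose M : 'M[{mpoly K[N]}]_m := \matrix_(i, j) w (fullrankfun fullU i) (e j).
have detM : \det (map_mx (meval x) M) != 0.
  have -> : map_mx (meval x) M = rowsub (fullrankfun fullU) U.
    apply/matrixP => i j; rewrite !mxE.
    by have [_ <-] := hw (fullrankfun fullU i); rewrite mxE.
  have := fullrowsub_unit fullU.
  by rewrite unitmxE unitfE.
have : map_mx phi M \in unitmx.
  rewrite unitmxE unitfE det_map_mx; apply: (phi_neq0 phi0 Xx).
  by move: detM; rewrite det_map_mx.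
move=> uM; apply: trmx_inj; rewrite trmx0.
apply: (can_inj (mulKmx uM)); rewrite mulmx0; apply/matrixP => i j.
rewrite ord1 !mxE; have [wi _] := hw (fullrankfun fullU i).
rewrite -[RHS](kv _ wi); apply: eq_bigr => k _.
by rewrite !mxE mulrC.
Qed.

End Family.
End KernelSpecialization.

(** * Polynomials of bounded degree as coefficient vectors *)

Section BoundedPolynomials.
Variables (R : nzRingType) (k d : nat).

Definition bmon (i : 'I_#|{: 'X_{1..k < d}}|) : 'X_{1..k} :=
  (enum_val i : 'X_{1..k < d}).

Definition poly_of_row (c : 'rV[R]_#|{: 'X_{1..k < d}}|) : {mpoly R[k]} :=
  \sum_i c 0 i *: 'X_[bmon i].

Definition row_of_poly (H : {mpoly R[k]}) : 'rV[R]_#|{: 'X_{1..k < d}}| :=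
  \row_i H@_(bmon i).

Lemma mcoeff_poly_of_row c i : (poly_of_row c)@_(bmon i) = c 0 i.
Proof.
rewrite /poly_of_row raddf_sum (bigD1 i) //= mcoeffZ mcoeffX eqxx mulr1.
rewrite big1 ?addr0 // => j ji; rewrite mcoeffZ mcoeffX.
case: eqP => [/val_inj/enum_val_inj e|_]; last by rewrite mulr0.
by rewrite e eqxx in ji.
Qed.

Lemma row_of_polyK H : (msize H <= d)%N -> poly_of_row (row_of_poly H) = H.
Proof.
move=> Hd; rewrite [RHS](mpolywE Hd) /poly_of_row.
rewrite (reindex (fun i : 'I_#|{: 'X_{1..k < d}}| => enum_val i)) /=.
  by apply: eq_bigr => i _; rewrite mxE.
exact/onW_bij/enum_val_bij.
Qed.

End BoundedPolynomials.

Section IndependentOverConstants.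
Variables (K : fieldType) (N : nat) (X : point K N -> Prop).
Variable F : ({mpoly K[N]} -> {mpoly K[N]}) -> Prop.
Hypothesis FX : forall D, F D -> vector_field_on X D.
Variables (E : fieldType) (phi : {rmorphism {mpoly K[N]} -> E}).
Hypothesis phi0 : forall f, phi f = 0 <-> vanishing_ideal X f.
Hypothesis phi_frac : forall x, exists f g, phi g != 0 /\ x = phi f / phi g.
Variables (k : nat) (s : 'I_k -> 'I_N).

Local Notation mons d := (fun i => coords s ('X_[@bmon k d i] : {mpoly K[k]})).

Lemma coords_poly_of_row d c :
  coords s (poly_of_row c) = \sum_i c 0 i *: mons d i.
Proof.
rewrite /poly_of_row raddf_sum; apply: eq_bigr => i _ /=.
by rewrite -!mul_mpolyC rmorphM /= coordsC.
Qed.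

Lemma meval_poly_of_row d (v : 'rV[E]_#|{: 'X_{1..k < d}}|) :
  (poly_of_row v).@[fun i => phi 'X_(s i)] = \sum_i v 0 i * phi (mons d i).
Proof.
rewrite /poly_of_row raddf_sum; apply: eq_bigr => i _.
rewrite /= mevalZ mevalX mpolyXE_id !rmorph_prod; congr (_ * _).
by apply: eq_bigr => j _; rewrite /= !rmorphXn /= coordsX.
Qed.

Lemma wideal_poly_of_row x d c :
  wideal F x (coords s (poly_of_row c)) <-> point_kernel F (mons d) x c.
Proof.
have e w : word F w -> (w (coords s (poly_of_row c))).@[x] =
    \sum_i c 0 i * (w (mons d i)).@[x].
  move=> ww; rewrite coords_poly_of_row (word_sum FX) // raddf_sum.
  by apply: eq_bigr => i _; rewrite /= (wordZ FX) // mevalZ.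
by split=> h w ww; [rewrite -e|rewrite e] => //; apply: h.
Qed.

(** Triviality of the kernel at one point passes to the generic point, and a relation over the
    constants is a vector of the generic kernel. *)
Lemma indep_point_const x : X x -> indep_mod (wideal F x) s ->
  aindep (const F phi) (fun i => phi 'X_(s i)).
Proof.
move=> Xx is_ H oH Hs; pose d := msize H.
have HE := row_of_polyK (leqnn d); rewrite -HE.
suff -> : row_of_poly d H = 0.
  by rewrite /poly_of_row big1 // => i _; rewrite mxE scale0r.
apply: (kernel_semicontinuity phi0 (e := mons d) Xx) => [c|].
  move=> /wideal_poly_of_row /is_ c0; apply/rowP => i.
  by rewrite -mcoeff_poly_of_row c0 mcoeff0 mxE.
apply: (const_relation_word FX phi0 phi_frac) => [i|].
  by rewrite mxE; apply/field_gen_const/oH.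
by rewrite -meval_poly_of_row HE.
Qed.

(** In each degree the kernel at a generic [x] lies in the span of specialized relations over the
    constants, and independence leaves none of these but zero. The degrees contribute countably many
    open sets. *)
Lemma indep_const_very_generically :
  aindep (const F phi) (fun i => phi 'X_(s i)) ->
  very_generically X (fun x => indep_mod (wideal F x) s).
Proof.
move=> is_; suff gen d : generically X
  (fun x => forall c, point_kernel F (mons d) x c -> c = 0).
  apply: very_generically_mono (very_generically_all gen) => x Xx h H wH.
  rewrite -(row_of_polyK (leqnn (msize H))).
  have -> : row_of_poly (msize H) H = 0.
    by apply/h/wideal_poly_of_row; rewrite row_of_polyK.
  by rewrite /poly_of_row big1 // => i _; rewrite mxE scale0r.
have [r [U [kU cU gU]]] := kernel_specialization F phi0 phi_frac (mons d).
apply: generically_mono gU => x Xx [_ hx] c /hx.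
suff -> : U = 0.
  have -> : map_mx (spec phi x) (0 : 'M[E]_(r, #|{: 'X_{1..k < d}}|)) = 0.
    by apply/matrixP => i j; rewrite !mxE; apply: (value_spec phi0 Xx); apply: value0.
  exact: submx0null.
apply/row_matrixP => j; rewrite row0; apply/rowP => i; rewrite [RHS]mxE.
suff /mpolyP/(_ (bmon i)) : poly_of_row (row j U) = 0.
  by rewrite mcoeff_poly_of_row mcoeff0.
apply: is_ => [m|]; last by rewrite meval_poly_of_row; apply: (kU j _ (word_id F)).
rewrite /poly_of_row raddf_sum; apply: field_gen_sum => a _; rewrite /= mcoeffZ mxE.
apply: field_genM; first by apply: field_gen_in; apply: cU.
by rewrite mcoeffX; case: (_ == _); [exact: field_gen1|exact: field_gen0].
Qed.

End IndependentOverConstants.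

(** * Hilbert's basis theorem *)

(** Keep choosing, past the last index, one at which [a] takes its least value from there on. *)
Lemma nat_monotone_subsequence (a : nat -> nat) :
  exists s : nat -> nat, {homo s : i j / (i < j)%N} /\
    {homo a \o s : i j / (i <= j)%N}.
Proof.
have minafter n : exists i, (n <= i)%N /\ forall j, (n <= j)%N -> (a i <= a j)%N.
  have ex : exists v, `[< exists i, (n <= i)%N /\ a i = v >].
    by exists (a n); apply/asboolP; exists n.
  have [v /asboolP [i [ni ai]] vmin] := ex_minnP ex; exists i; split=> // j nj.
  by rewrite ai; apply: vmin; apply/asboolP; exists j.
have [next hnext] := choice minafter.
pose s := fix s i := if i is i'.+1 then next (s i').+1 else next 0%N.
have sS i : (s i < s i.+1)%N by have [] := hnext (s i).+1.
have smin i : forall j, (s i <= j)%N -> (a (s i) <= a j)%N.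
  case: i => [|i] j sj; first by have [_] := hnext 0%N; apply.
  have [h1 h2] := hnext (s i).+1; apply: h2; exact: leq_trans h1 sj.
have sinc : {homo s : i j / (i < j)%N} by apply: homo_ltn => //; exact: ltn_trans.
exists s; split=> // i j ij; apply: smin.
by move: ij; rewrite leq_eqVlt => /orP [/eqP->//|/sinc/ltnW].
Qed.

(** A subsequence along which the first [k] exponents do not decrease is thinned out to include the
    next exponent. *)
Lemma dickson n (m : nat -> 'X_{1..n}) :
  exists i j, (i < j)%N /\ (m i <= m j)%MM.
Proof.
suff /(_ n (leqnn n)) [s [sinc hs]] : forall k, (k <= n)%N ->
    exists s : nat -> nat, {homo s : i j / (i < j)%N} /\
      forall (c : 'I_n), (c < k)%N -> {homo (fun i => m (s i) c) : i j / (i <= j)%N}.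
  exists (s 0%N), (s 1%N); split; first exact: sinc.
  by apply/mnm_lepP => c; apply: (hs c (ltn_ord c) 0%N 1%N).
elim=> [|k IHk] kn; first by exists id; split.
have [s [sinc hs]] := IHk (ltnW kn).
have [t [tinc ht]] := nat_monotone_subsequence (fun i => m (s i) (Ordinal kn)).
exists (s \o t); split=> [i j /tinc/sinc //|c].
have tle : {homo t : i j / (i <= j)%N}.
  by move=> i j; rewrite leq_eqVlt => /orP [/eqP->//|/tinc/ltnW].
rewrite ltnS leq_eqVlt => /orP [/eqP ck|ck] i j ij.
  have -> : c = Ordinal kn by exact: val_inj.
  exact: ht.
by apply: (hs c ck); apply: tle.
Qed.

Section HilbertBasis.
Variables (K : fieldType) (n : nat).
Implicit Types (f g h : {mpoly K[n]}) (l : seq {mpoly K[n]}).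

Fixpoint in_span l f : Prop :=
  if l is h :: l' then exists a, in_span l' (f - a * h) else f = 0.

Lemma in_span_ideal l : is_ideal (in_span l).
Proof.
elim: l => [|h l [IH0 IHD IHM]] /=.
  by split=> // [f g -> ->|f g ->]; rewrite ?addr0 ?mulr0.
split.
- by exists 0; rewrite mul0r subr0.
- move=> f g [a fa] [b gb]; exists (a + b).
  by rewrite mulrDl opprD addrACA; apply: IHD.
- move=> f g [a ga]; exists (f * a).
  by rewrite -mulrA -mulrBr; apply: IHM.
Qed.

Lemma in_span_cons h l f : in_span l f -> in_span (h :: l) f.
Proof. by move=> lf; exists 0; rewrite mul0r subr0. Qed.

Lemma in_span_head h l : in_span (h :: l) h.
Proof. by exists 1; rewrite mul1r subrr; apply: ideal0 (in_span_ideal l). Qed.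

(** [Q] is an arbitrary set and the generators are taken from it, which later keeps their
    coefficients constant. In a strictly growing sequence of spans, let [g i] be a new element of
    least leading monomial. By Dickson's lemma a multiple of some [g i] cancels the leading term of
    a later [g j], against minimality. *)
Theorem hilbert_basis (Q : {mpoly K[n]} -> Prop) :
  exists l, (forall h, h \in l -> Q h) /\ forall f, Q f -> in_span l f.
Proof.
apply: contrapT => nl.
have /choice[nxt hnxt] l : exists h, (forall g, g \in l -> Q g) -> Q h /\ ~ in_span l h.
  have [Ql|nQl] := pselect (forall g, g \in l -> Q g); last by exists 0.
  apply: contrapT => nh; apply: nl; exists l; split=> // f Qf.
  by apply: contrapT => nf; apply: nh; exists f.
pose L := fix L i := if i is i'.+1 then nxt (L i') :: L i' else [::].
have QL i : forall g, g \in L i -> Q g.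
  elim: i => // i IH g; rewrite inE => /orP [/eqP->|/IH //].
  by have [] := hnxt _ IH.
have subL i j f : (i <= j)%N -> in_span (L i) f -> in_span (L j) f.
  move=> /subnK <-; elim: (j - i)%N => // d IH fi.
  by rewrite addSn; apply/in_span_cons/IH.
have /choice[g hg] i : exists g, [/\ in_span (L i.+1) g, ~ in_span (L i) g
    & forall g', in_span (L i.+1) g' -> ~ in_span (L i) g' -> (mlead g <= mlead g')%O].
  have [_ nn] := hnxt _ (QL i); have := in_span_head (nxt (L i)) (L i).
  rewrite -/(L i.+1); move: (nxt (L i)) nn => h.
  move: {2}(mlead h) (erefl (mlead h)) => m.
  elim/(well_founded_ind (@ltom_wf n)): m h => m IH h hm nh ih.
  have [[g' [g'm ig' ng']]|none] := pselect (exists g',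
      [/\ (mlead g' < m)%O, in_span (L i.+1) g' & ~ in_span (L i) g']).
    exact: IH g'm g' erefl ng' ig'.
  exists h; split=> // g' ig' ng'; rewrite leNgt; apply/negP => lt_g.
  by apply: none; exists g'; rewrite -hm.
have g0 i : g i != 0.
  have [_ ng _] := hg i; apply: contra_notN ng => /eqP->.
  exact: ideal0 (in_span_ideal _).
have [i [j [ij mij]]] := dickson (fun i => mlead (g i)).
have [gi _ _] := hg i; have [gj ngj minj] := hg j.
pose c := mleadc (g j) / mleadc (g i).
pose h := c *: 'X_[mlead (g j) - mlead (g i)] * g i.
have c0 : c != 0 by rewrite mulf_neq0 ?invr_eq0 ?mleadc_eq0.
have X0 : c *: 'X_[mlead (g j) - mlead (g i)] != 0 :> {mpoly K[n]}.
  by rewrite scaler_eq0 (negPf c0) /= -msize_poly_eq0 msizeX.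
have lead_h : mlead h = mlead (g j).
  by rewrite /h mleadM // mleadZ // mleadXm submK.
have leadc_h : mleadc h = mleadc (g j).
  have ea : mlead (g j) = (mlead (g j) - mlead (g i) + mlead (g i))%MM by rewrite submK.
  rewrite lead_h [X in h@_X]ea /h -scalerAl mcoeffZ ['X_[_] * _]mulrC mcoeffMX.
  by rewrite divfK ?mleadc_eq0.
have ih : in_span (L j) h.
  by apply: idealM; [exact: in_span_ideal|apply: subL gi].
have ngjh : ~ in_span (L j) (g j - h).
  move=> gjh; apply: ngj; rewrite -(subrK h (g j)).
  by apply: idealD gjh ih; apply: in_span_ideal.
have /minj/(_ ngjh) : in_span (L j.+1) (g j - h).
  by apply: idealB gj (in_span_cons _ ih); apply: in_span_ideal.
have := mleadB_le (g j) h; rewrite lead_h joinxx => le1 le2.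
have eq_lead : mlead (g j - h) = mlead (g j) by apply/le_anti; rewrite le1 le2.
apply: ngjh; suff -> : g j - h = 0 by apply: ideal0 (in_span_ideal _).
by apply/eqP; rewrite -mleadc_eq0 eq_lead mcoeffB -{2}lead_h leadc_h subrr.
Qed.

End HilbertBasis.

(** * Finite character of algebraic dependence *)

Section FiniteAlgebraicity.
Variable E : fieldType.
Implicit Types (S : E -> Prop) (l t u : seq E).

Lemma field_gen_finite S x : field_gen S x ->
  exists l, (forall y, y \in l -> S y) /\ field_gen (fun y => y \in l) x.
Proof.
have mono l l' y : field_gen (fun z => z \in l) y ->
    field_gen (fun z => z \in l ++ l') y /\ field_gen (fun z => z \in l' ++ l) y.
  move=> ly; split; apply: field_gen_mono ly => z zl; apply: field_gen_in;
    by rewrite mem_cat zl ?orbT.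
elim=> {x} [x Sx||x y _ [l [Sl lx]] _ [l' [Sl' ly]]|
  x y _ [l [Sl lx]] _ [l' [Sl' ly]]|x _ [l [Sl lx]]].
- exists [:: x]; split; first by move=> y; rewrite inE => /eqP->.
  by apply: field_gen_in; rewrite inE.
- by exists [::]; split=> //; apply: field_gen1.
- exists (l ++ l'); split; first by move=> z; rewrite mem_cat => /orP [/Sl|/Sl'].
  by apply: field_genB; [apply: (mono _ _ _ lx).1|apply: (mono _ _ _ ly).2].
- exists (l ++ l'); split; first by move=> z; rewrite mem_cat => /orP [/Sl|/Sl'].
  by apply: field_genM; [apply: (mono _ _ _ lx).1|apply: (mono _ _ _ ly).2].
- by exists l; split=> //; apply: field_genV.
Qed.

Lemma acl_finite S x : acl S x ->
  exists l, (forall y, y \in l -> S y) /\ acl (fun y => y \in l) x.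
Proof.
move=> [p [p0 gp px]]; have /choice[l hl] i := field_gen_finite (gp i).
exists (flatten [seq l i | i <- iota 0 (size p)]); split.
  by move=> y /flatten_mapP [i _ yl]; exact: (hl i).1 yl.
exists p; split=> // i; have [ip|/leq_sizeP -> //] := ltnP i (size p); last exact: field_gen0.
have [_ li] := hl i; apply: field_gen_mono li => y yl; apply: field_gen_in.
by apply/flatten_mapP; exists i; rewrite ?mem_iota.
Qed.

Lemma acl_adjoins_finite S u x : acl (adjoins S u) x ->
  exists l, (forall y, y \in l -> S y) /\ acl (adjoins (fun y => y \in l) u) x.
Proof.
move=> /acl_finite [l [Sl lx]]; exists [seq y <- l | `[< S y >]]; split.
  by move=> y; rewrite mem_filter => /andP [/asboolP].
apply: acl_mono lx => y yl; have [Sy|yu] := Sl y yl; [left|by right].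
by rewrite mem_filter yl andbT; apply/asboolP.
Qed.

Lemma finite_basis S l : exists t,
  [/\ {subset t <= l}, lindep S t & forall x, x \in l -> acl (adjoins S t) x].
Proof.
elim: l => [|a l [t [tl it lt]]]; first by exists [::].
have [at_|nat] := pselect (acl (adjoins S t) a).
  exists t; split=> // [x /tl xl|x]; first by rewrite inE xl orbT.
  by rewrite inE => /orP [/eqP->|/lt].
exists (a :: t); split=> // [x|x].
  by rewrite !inE => /orP [->//|/tl->]; rewrite orbT.
rewrite inE => /orP [/eqP->|/lt xt]; first by apply: acl_in; right; rewrite inE eqxx.
by apply: acl_mono xt => y [Sy|yt]; [left|right; rewrite inE yt orbT].
Qed.

Lemma olist_surj t : exists u : 'I_(size t) -> E, olist u = t.
Proof.
elim: t => [|a t [u ut]]; first by exists (fun=> 0).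
exists (extend_last u a); rewrite /= extend_last_max; congr (_ :: _).
rewrite -[RHS]ut; congr (olist _); apply/funext => i; exact: extend_last_wid.
Qed.

End FiniteAlgebraicity.

(** * The fibration by leaves *)

Section PolynomialSpecialization.
Variables (K : fieldType) (N : nat) (X : point K N -> Prop).
Variables (E : fieldType) (phi : {rmorphism {mpoly K[N]} -> E}).
Hypothesis phi0 : forall f, phi f = 0 <-> vanishing_ideal X f.
Hypothesis phi_frac : forall x, exists f g, phi g != 0 /\ x = phi f / phi g.
Implicit Types (x z : point K N).

Local Notation spec := (spec phi).
Local Notation regular := (regular phi).
Local Notation has_value := (has_value phi).

Section Values.
Variable k : nat.
Implicit Types (G H : {mpoly E[k]}) (g h : {mpoly K[k]}).

Definition poly_value x G g := forall m, has_value x G@_m g@_m.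

Lemma poly_value_sub x G H g h : X x -> poly_value x G g -> poly_value x H h ->
  poly_value x (G - H) (g - h).
Proof.
move=> Xx vG vH m; rewrite !mcoeffB; apply: (value_add phi0) => //.
by rewrite -[- H@_m]mulN1r -[- h@_m]mulN1r; apply: value_mul (vH m);
  rewrite -(rmorph1 phi) -rmorphN -[X in has_value _ _ (- X)](meval1 x) -mevalN;
  apply: value_phi.
Qed.

Lemma poly_value_mul x G H g h : X x -> poly_value x G g -> poly_value x H h ->
  poly_value x (G * H) (g * h).
Proof.
move=> Xx vG vH m; rewrite !mcoeffM; apply: (value_sum phi0) => // i _.
exact: value_mul.
Qed.

Lemma poly_value_unique x G g g' : X x -> poly_value x G g -> poly_value x G g' ->
  g = g'.
Proof.
by move=> Xx vg vg'; apply/mpolyP => m; apply: (has_value_unique phi0 Xx (vg m) (vg' m)).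
Qed.

Lemma poly_value_exists x G : X x -> (forall m, m \in msupp G -> regular x G@_m) ->
  exists g, poly_value x G g.
Proof.
move=> Xx rG; exists (\sum_(m <- msupp G) spec x G@_m *: 'X_[m]) => m.
have -> : (\sum_(m <- msupp G) spec x G@_m *: 'X_[m])@_m = spec x G@_m.
  rewrite raddf_sum /=; have [mG|mG] := boolP (m \in msupp G).
    rewrite (bigD1_seq m) ?msupp_uniq //= mcoeffZ mcoeffX eqxx mulr1.
    rewrite big1 ?addr0 // => m' m'm; rewrite mcoeffZ mcoeffX.
    by rewrite (negPf m'm) mulr0.
  rewrite (memN_msupp_eq0 mG) (value_spec phi0 Xx (value0 phi x)).
  rewrite big_seq big1 // => m' m'G; rewrite mcoeffZ mcoeffX.
  by case: eqP => [e|_]; [rewrite e (negPf mG) in m'G|rewrite mulr0].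
have [mG|mG] := boolP (m \in msupp G); first by apply: regular_spec; apply: rG.
by rewrite (memN_msupp_eq0 mG) (value_spec phi0 Xx (value0 phi x)); apply: value0.
Qed.

Lemma poly_value_generically G :
  generically X (fun x => exists g, poly_value x G g).
Proof.
have := generically_all phi0 (fun i : 'I_(size (msupp G)) =>
  generically_regular phi0 phi_frac (G@_(nth 0%MM (msupp G) i))).
apply: generically_mono => x Xx rG; apply: poly_value_exists => // m mG.
have im : (index m (msupp G) < size (msupp G))%N by rewrite index_mem.
by have := rG (Ordinal im); rewrite /= nth_index.
Qed.

(** The multipliers of the combination have arbitrary coefficients in [E], but these too are regular
    at generic [x]. Only coefficients are specialized at [x]; the argument [z] is unrelated to
    it. *)
Lemma span_value l G : in_span l G ->
  generically X (fun x => forall g (z : point K k), poly_value x G g ->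
    (forall H, H \in l -> exists2 h, poly_value x H h & h.@[z] = 0) ->
    g.@[z] = 0).
Proof.
elim: l G => [|H l IHl] G.
  move=> ->; exists 1; split=> [/phi0|x Xx _ g z vg _].
    by rewrite rmorph1 => /eqP; rewrite oner_eq0.
  rewrite (@poly_value_unique x 0 g 0) ?meval0 // => m.
  by rewrite !mcoeff0; apply: value0.
move=> [a /IHl gl]; have := generically_and phi0 gl (poly_value_generically a).
apply: generically_mono => x Xx [hl [a' va]] g z vg vl.
have [|h' vh h'z] := vl H; first by rewrite inE eqxx.
have := hl (g - a' * h') z; rewrite mevalB mevalM h'z mulr0 subr0; apply.
  by apply: poly_value_sub => //; apply: poly_value_mul.
by move=> H1 H1l; apply: vl; rewrite inE H1l orbT.
Qed.

End Values.

Lemma poly_value_meval z (H : {mpoly E[N]}) h : X z -> poly_value z H h ->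
  has_value z H.@[fun i => phi 'X_i] h.@[z].
Proof.
move=> Xz vH; pose d := maxn (msize H) (msize h).
rewrite (mpolywE (leq_maxl (msize H) (msize h) : (msize H <= d)%N)).
rewrite (mpolywE (leq_maxr (msize H) (msize h) : (msize h <= d)%N)).
rewrite !raddf_sum /=; apply: (value_sum phi0) => // m _.
rewrite !mevalZ; apply: value_mul => //; rewrite mevalX.
have -> : \prod_(i < N) phi 'X_i ^+ m i = phi 'X_[m].
  by rewrite mpolyXE_id rmorph_prod; apply: eq_bigr => i _; rewrite rmorphXn.
exact: value_phi.
Qed.

End PolynomialSpecialization.

Section ConstantsDetermineLeaves.
Variables (K : fieldType) (N : nat) (X : point K N -> Prop).
Variable F : ({mpoly K[N]} -> {mpoly K[N]}) -> Prop.
Hypothesis FX : forall D, F D -> vector_field_on X D.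
Variables (E : fieldType) (phi : {rmorphism {mpoly K[N]} -> E}).
Hypothesis phi0 : forall f, phi f = 0 <-> vanishing_ideal X f.
Hypothesis phi_frac : forall x, exists f g, phi g != 0 /\ x = phi f / phi g.
Implicit Types (x z : point K N).

Local Notation spec := (spec phi).
Local Notation regular := (regular phi).
Local Notation has_value := (has_value phi).

Definition same_values (l : seq E) x z := forall y, y \in l ->
  [/\ regular x y, regular z y & spec z y = spec x y].

(** The basis theorem is applied over [E] to the polynomials with constant coefficients that vanish
    at the generic point [xi]; [l] collects the coefficients of the generators. An element of I(F,x)
    of bounded degree is a combination of such relations specialized at [x], so it vanishes where
    the specialized generators do. *)
Lemma constants_determine_leaf : exists l : seq E,
  (forall y, y \in l -> const F phi y) /\
  very_generically X (fun x => forall z, X z -> same_values l x z ->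
    zero_set (wideal F x) z).
Proof.
pose xi := fun i => phi ('X_i : {mpoly K[N]}).
have [lH [QlH spanH]] := hilbert_basis
  (fun H : {mpoly E[N]} => overm (const F phi) H /\ H.@[xi] = 0).
pose l := flatten [seq [seq H@_m | m <- msupp H] | H : {mpoly E[N]} <- lH].
have lP (H : {mpoly E[N]}) m : H \in lH -> m \in msupp H -> H@_m \in l.
  by move=> HlH mH; apply/flatten_mapP; exists H => //; apply: map_f.
exists l; split.
  move=> y /flatten_mapP [H /QlH [oH _]] /mapP [m _ ->].
  exact/field_gen_const/oH.
have gen d : generically X (fun x => forall z, X z -> same_values l x z ->
    forall f, (msize f <= d)%N -> wideal F x f -> f.@[z] = 0).
  pose e i := 'X_[@bmon N d i] : {mpoly K[N]}.
  have [r [U [kU cU gU]]] := kernel_specialization F phi0 phi_frac e.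
  pose HU j := poly_of_row (row j U).
  have gH : generically X (fun x => forall j g (z : point K N),
      poly_value phi x (HU j) g ->
      (forall H, H \in lH -> exists2 h, poly_value phi x H h & h.@[z] = 0) ->
      g.@[z] = 0).
    apply: generically_all => // j; apply: span_value => //; apply: spanH; split.
      move=> m; rewrite /HU /poly_of_row raddf_sum; apply: field_gen_sum => i _.
      rewrite /= mcoeffZ mxE; apply: field_genM; first by apply/field_gen_in/cU.
      by rewrite mcoeffX; case: (_ == _); [exact: field_gen1|exact: field_gen0].
    rewrite /HU /poly_of_row raddf_sum -[RHS](kU j _ (word_id F)).
    apply: eq_bigr => i _; rewrite /= mevalZ mevalX; congr (_ * _).
    rewrite /e mpolyXE_id rmorph_prod; apply: eq_bigr => a _.
    by rewrite rmorphXn.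
  have := generically_and phi0 gU gH; apply: generically_mono.
  move=> x Xx [[rU hU] hH] z Xz xz f fd wf.
  (* Equal values of the coefficients make [h] the specialization of [H] at [z] as well, where
     [H.@[xi] = 0] becomes [h.@[z] = 0]. *)
  have vlH H : H \in lH -> exists2 h, poly_value phi x H h & h.@[z] = 0.
    move=> HlH; have [|h vh] := poly_value_exists phi0 Xx (G := H).
      by move=> m /(lP H m HlH)/xz [].
    exists h => //; have vz : poly_value phi z H h.
      move=> m; have [mH|mH] := boolP (m \in msupp H); last first.
        have := vh m; rewrite (memN_msupp_eq0 mH) => v0.
        by rewrite -(has_value_unique phi0 Xx (value0 phi x) v0); apply: value0.
      have [_ rz sz] := xz _ (lP _ _ HlH mH).
      by rewrite -(value_spec phi0 Xx (vh m)) -sz; apply: regular_spec.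
    have := poly_value_meval phi0 Xz vz; rewrite (QlH _ HlH).2 => v0.
    by rewrite (has_value_unique phi0 Xz v0 (value0 phi z)).
  pose c := row_of_poly d f.
  have fc : f = poly_of_row c by rewrite row_of_polyK.
  have /hU /submxP [b cb] : point_kernel F e x c.
    move=> w ww; have := wf w ww; rewrite {1}fc /poly_of_row (word_sum FX) //.
    rewrite raddf_sum => h; rewrite -[RHS]h; apply: eq_bigr => i _.
    by rewrite /= (wordZ FX) // mevalZ.
  pose hrow j := poly_of_row (row j (map_mx (spec x) U)).
  have vU j : poly_value phi x (HU j) (hrow j).
    move=> m; rewrite /HU /hrow /poly_of_row !raddf_sum.
    apply: (value_sum phi0) => // i _; rewrite /= !mcoeffZ !mxE.
    apply: value_mul; first exact: regular_spec.
    by rewrite !mcoeffX; case: (_ == _); [exact: value1|exact: value0].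
  have gz j : (hrow j).@[z] = 0 by apply: hH (vU j) vlH.
  transitivity (\sum_j b 0 j * (hrow j).@[z]); last first.
    by apply: big1 => j _; rewrite gz mulr0.
  rewrite fc cb /poly_of_row raddf_sum.
  rewrite (eq_bigr (fun j => \sum_i b 0 j * (spec x (U j i) * ('X_[bmon i]).@[z]))).
    rewrite exchange_big; apply: eq_bigr => i _.
    rewrite /= mevalZ mxE mulr_suml; apply: eq_bigr => j _.
    by rewrite !mxE mulrA.
  move=> j _; rewrite /hrow /poly_of_row raddf_sum mulr_sumr; apply: eq_bigr => i _.
  by rewrite /= mevalZ !mxE.
apply: very_generically_mono (very_generically_all gen) => x Xx h z Xz xz f wf.
exact: (h (msize f) z Xz xz f (leqnn _) wf).
Qed.

End ConstantsDetermineLeaves.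

Section Chains.
Variables (K : fieldType) (N : nat).
Implicit Types (Z : point K N -> Prop).

Lemma has_chain_incl Z Z' k : incl Z Z' -> has_chain Z k -> has_chain Z' k.
Proof. by move=> ZZ' [C [Cirr Cinc CZ]]; exists C; split=> // z /CZ /ZZ'. Qed.

Lemma has_chain_le Z k k' : (k <= k')%N -> has_chain Z k' -> has_chain Z k.
Proof.
move=> /subnK <-; elim: (k' - k)%N => // d IH [C [Cirr Cinc CZ]].
apply: IH; exists C; split=> [i id|i id|z Cz].
- exact/Cirr/leqW.
- exact/Cinc/leqW.
- by apply/CZ/(Cinc (d + k)%N (ltnSn _)).1.
Qed.

End Chains.

(** * Transcendence degree of the constants and construction of the map *)

Section Main.
Variables (K : closedFieldType) (N n p : nat) (X : point K N -> Prop).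
Hypothesis Kunc : uncountable K.
Variable F : ({mpoly K[N]} -> {mpoly K[N]}) -> Prop.
Hypothesis Xirr : irreducible_closed X.
Hypothesis Xdim : dim_eq X n.
Hypothesis FX : forall D, F D -> vector_field_on X D.
Hypothesis p_attained : exists x, X x /\ dim_eq (Vfol_pt X F x) p.
Hypothesis p_max : forall x d, X x -> dim_eq (Vfol_pt X F x) d -> (d <= p)%N.
Variables (E : fieldType) (phi : {rmorphism {mpoly K[N]} -> E}).
Hypothesis phi0 : forall f, phi f = 0 <-> vanishing_ideal X f.
Hypothesis phi_frac : forall x, exists f g, phi g != 0 /\ x = phi f / phi g.
Implicit Types (x z : point K N).

Local Notation spec := (spec phi).
Local Notation regular := (regular phi).
Local Notation has_value := (has_value phi).
Local Notation L := (const F phi).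
Local Notation S0 := (scalars phi).

Lemma X_closed : zariski_closed X. Proof. by case: Xirr. Qed.

Lemma zero_set_XE z : zero_set (vanishing_ideal X) z <-> X z.
Proof. by split=> [/(closed_zero_set X_closed)|Xz f]; last exact. Qed.

Lemma VfolE x z : X x -> Vfol_pt X F x z <-> zero_set (wideal F x) z.
Proof.
move=> Xx; split=> h f; first by move=> /(foliation_idealE FX f Xx) /h.
by move=> /(foliation_idealE FX f Xx) /h.
Qed.

Lemma leaf_sub_X x z : X x -> zero_set (wideal F x) z -> X z.
Proof.
move=> Xx wz; apply/zero_set_XE => f Pf; apply: wz => w ww.
exact: (wordP FX ww Pf).
Qed.

Lemma very_generic_point Q : very_generically X Q -> exists2 x, X x & Q x.
Proof.
move=> [b [Pb bQ]].
have [x /zero_set_XE Xx bx] := prime_very_generic_point Kunc (irreducible_prime Xirr) Pb.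
by exists x => //; apply: bQ.
Qed.

Lemma generic_point Q : generically X Q -> exists2 x, X x & Q x.
Proof. by move=> /very_generically_generic/very_generic_point. Qed.

Lemma leaf_rank_attained :
  exists s : 'I_p -> 'I_N, aindep L (fun i => phi 'X_(s i)).
Proof.
have [x [Xx [cx _]]] := p_attained.
have [|s is_] := (has_chain_indep Kunc p (wideal_ideal FX x)).1.
  by apply: has_chain_incl cx => z /(VfolE _ Xx).
by exists s; apply: (indep_point_const FX phi0 phi_frac Xx).
Qed.

(** [p_max] bounds only dimensions known exactly. A chain of length [p.+1] in a leaf therefore has
    to be extendable to every length, which exceeds the dimension of [X]. *)
Lemma leaf_rank_max (s : 'I_p.+1 -> 'I_N) : ~ aindep L (fun i => phi 'X_(s i)).
Proof.
move=> /(indep_const_very_generically FX phi0 phi_frac)/very_generic_point [x Xx is_].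
have chain d : has_chain (Vfol_pt X F x) (p.+1 + d).
  elim: d => [|d IHd].
    rewrite addn0; apply: (has_chain_incl (Z := zero_set (wideal F x))).
      by move=> z /(VfolE _ Xx).
    by apply/(has_chain_indep Kunc _ (wideal_ideal FX x)); exists s.
  rewrite addnS; apply: contrapT => nd.
  have := p_max Xx (conj IHd nd); rewrite leqNgt => /negP; apply.
  exact: leq_addr.
have [_ nX] := Xdim; apply: nX; apply: (has_chain_le (k' := (p.+1 + n.+1)%N)).
  exact: leq_addl.
by apply: has_chain_incl (chain n.+1) => z /(VfolE _ Xx)/(leaf_sub_X Xx).
Qed.

Lemma transcendence_basis : exists2 u : seq E, size u = n /\ lindep S0 u
  & forall e, acl (adjoins S0 u) e.
Proof.
have [cX nX] := Xdim; have iP := vanishing_ideal_ideal X.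
have XE k : has_chain X k <-> exists s : 'I_k -> 'I_N, indep_mod (vanishing_ideal X) s.
  split=> [cXk|h].
    apply/(has_chain_indep Kunc _ iP); apply: has_chain_incl cXk => z.
    exact: (zero_set_XE z).2.
  apply: (has_chain_incl (Z := zero_set (vanishing_ideal X))).
    by move=> z /zero_set_XE.
  exact/(has_chain_indep Kunc _ iP).
have [s /(indep_mod_aindep phi0) is_] := (XE n).1 cX.
exists (olist (fun i => phi 'X_(s i))).
  by rewrite size_olist; split=> //; apply/aindep_lindep.
apply: (acl_generators_all phi_frac) => [x Sx|j]; first by apply: acl_in; left.
apply: contrapT => nj; apply: nX; apply/XE; exists (extend_last s j).
by apply/(indep_mod_aindep phi0)/aindep_extend.
Qed.

(** The leaf coordinates, independent over the constants, remain independent together with [t];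
    Steinitz bounds the total by a transcendence basis of [E]. *)
Lemma const_lindep_size t : (forall y, y \in t -> L y) -> lindep S0 t ->
  (size t + p <= n)%N.
Proof.
move=> Lt it; have [u [<- _] allu] := transcendence_basis.
have [s /aindep_lindep is_] := leaf_rank_attained.
have := @steinitz _ S0 u (olist (fun i => phi 'X_(s i)) ++ t) [::].
rewrite !cats0 size_cat size_olist addnC; apply; last by move=> x _; exact: allu.
by apply: (lindep_extend is_) => // x; apply: (const_scalars FX).
Qed.

(** Only finitely many constants occur in the equations that make the coordinates algebraic over the
    constants and the leaf coordinates. Larger lists [l'] are allowed because the components of the
    map must also include the constants that determine leaves. *)
Lemma generating_constants : exists l : seq E, (forall y, y \in l -> L y) /\
  forall l' : seq E, {subset l <= l'} -> (forall y, y \in l' -> L y) ->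
    exists t : seq E, [/\ {subset t <= l'}, lindep S0 t & (size t + p = n)%N].
Proof.
have [s is_] := leaf_rank_attained.
have gen j : acl (adjoins L (olist (fun i => phi 'X_(s i)))) (phi 'X_j).
  apply: contrapT => nj; apply: (leaf_rank_max (s := extend_last s j)).
  exact: aindep_extend.
have /choice[lj hlj] j := acl_adjoins_finite (gen j).
exists (flatten [seq lj j | j <- enum 'I_N]); split.
  by move=> y /flatten_mapP [j _ /(hlj j).1].
move=> l' sub Ll'; have [t [tl it lt]] := finite_basis S0 l'.
have Lt y : y \in t -> L y by move=> /tl/Ll'.
exists t; split=> //; apply/eqP; rewrite eqn_leq const_lindep_size //=.
have [u [<- iu] _] := transcendence_basis.
have := @steinitz _ S0 (t ++ olist (fun i => phi 'X_(s i))) u [::].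
rewrite !cats0 size_cat size_olist; apply=> // x _.
apply: (acl_generators_all phi_frac) => [y Sy|j]; first by apply: acl_in; left.
have := (hlj j).2; apply: acl_trans => y [yl|yu]; last first.
  by apply: acl_in; right; rewrite mem_cat yu orbT.
apply: acl_mono (lt y _) => [a [Sa|at_]|]; [by left|by right; rewrite mem_cat at_|].
by apply/sub/flatten_mapP; exists j; rewrite ?mem_enum.
Qed.

Lemma value_mmap z m (g : 'I_m -> E) (y : point K m) (H : {mpoly K[m]}) :
  X z -> (forall i, has_value z (g i) (y i)) ->
  has_value z (mmap (scalar_map phi) g H) H.@[y].
Proof.
move=> Xz gy; rewrite mevalE /mmap; apply: (value_sum phi0) => // a _.
apply: value_mul; first by rewrite -[X in has_value _ _ X](mevalC z); apply: value_phi.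
rewrite /mmap1; apply: (big_ind2 (has_value z)) => [||i _].
- exact: value1.
- by move=> *; apply: value_mul.
elim: (a i) => [|c IHc]; first exact: value1.
by rewrite !exprS; apply: value_mul.
Qed.

Lemma ratval_value f g z c : X z -> phi g != 0 ->
  ratval X f g z c <-> has_value z (phi f / phi g) c.
Proof.
move=> Xz g0; split=> [[a [b [bz Pab ->]]]|[a [b [bz eab ->]]]].
  have b0 := phi_neq0 phi0 Xz bz; exists a, b; split=> //.
  apply/eqP; rewrite eqr_div // -!rmorphM -subr_eq0 -rmorphB -oppr_eq0 -rmorphN.
  by rewrite opprB; apply/eqP/phi0.
have b0 := phi_neq0 phi0 Xz bz; exists a, b; split=> //; apply/phi0/eqP.
rewrite rmorphB !rmorphM subr_eq0 eq_sym; move/eqP: eab.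
by rewrite eqr_div.
Qed.

Lemma generically_nonzero e : e != 0 ->
  generically X (fun x => exists2 c, has_value x e c & c != 0).
Proof.
have [f [g [g0 ->]]] := phi_frac e; rewrite mulf_eq0 negb_or => /andP [f0 _].
exists (f * g); split=> [/phi0/eqP|x Xx].
  by rewrite rmorphM mulf_eq0 (negPf f0) (negPf g0).
rewrite mevalM mulf_eq0 negb_or => /andP [fx gx].
by exists (f.@[x] / g.@[x]); [exists f, g|rewrite mulf_neq0 ?invr_eq0].
Qed.

Lemma generically_denominators m (b : 'I_m -> {mpoly K[N]}) :
  (forall i, phi (b i) != 0) -> generically X (fun x => forall i, (b i).@[x] != 0).
Proof.
move=> b0; apply: generically_all => // i; exists (b i); split=> // /phi0 bi.
by move: (b0 i); rewrite bi eqxx.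
Qed.

Lemma ratfun_neq0 (b : {mpoly K[N]}) a : phi b != 0 -> rational_function X a b.
Proof. by move=> /eqP b0 /phi0. Qed.

Lemma alg_indep_aindep m (a b : 'I_m -> {mpoly K[N]}) :
  (forall i, phi (b i) != 0) ->
  alg_indep X a b <-> aindep S0 (fun i => phi (a i) / phi (b i)).
Proof.
move=> b0; set u := fun i => _.
have val x (y := fun i => (a i).@[x] / (b i).@[x]) H : X x ->
    (forall i, (b i).@[x] != 0) -> has_value x (mmap (scalar_map phi) u H) H.@[y].
  by move=> Xx bx; apply: value_mmap => // i; exists (a i), (b i).
rewrite aindep_scalars; split=> [ind H uH|ind H H0].
  apply/eqP/negPn/negP => /ind [z [Xz bz]]; rewrite /eval_at => /eqP; apply.
  by apply: (has_value_unique phi0 Xz (val z H Xz bz)); rewrite uH; apply: value0.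
have uH : mmap (scalar_map phi) u H != 0 by apply: contra_neq H0; apply: ind.
have [z Xz [bz [c vc c0]]] := generic_point
  (generically_and phi0 (generically_denominators b0) (generically_nonzero uH)).
exists z; split=> //; apply: contra_neq c0 => e0.
by rewrite (has_value_unique phi0 Xz vc (val z H Xz bz)).
Qed.

Lemma const_word e w f g : L e -> word F w -> phi f = e * phi g ->
  phi (w f) = e * phi (w g).
Proof.
move=> ce ww; elim: ww f g => // D w' FD _ IH f g fg; apply: IH.
have [delta eD] := exists_extension FX phi0 phi_frac FD.
by rewrite -!(delta_phi eD) fg (delta_mul eD) (ce D delta FD eD) mul0r addr0.
Qed.

(** For [e = phi f / phi g] constant, every word satisfies [phi (w f) = e * phi (w g)]; evaluate at
    [x]. This places the leaf inside the fibre. *)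
Lemma wideal_const f g x : X x -> g.@[x] != 0 -> L (phi f / phi g) ->
  wideal F x (f - (f.@[x] / g.@[x]) *: g).
Proof.
move=> Xx gx ce w ww; have g0 := phi_neq0 phi0 Xx gx.
have fg : phi f = phi f / phi g * phi g by rewrite divfK.
have := value_phi phi x (w f); rewrite (const_word ce ww fg) => v1.
have v2 : has_value x (phi f / phi g * phi (w g)) (f.@[x] / g.@[x] * (w g).@[x]).
  by apply: value_mul; [exists f, g|exact: value_phi].
rewrite -scaleNr (wordD FX) // (wordZ FX) // mevalD mevalZ mulNr.
by rewrite (has_value_unique phi0 Xx v1 v2) subrr.
Qed.

Lemma very_generically_very_generic Q : very_generically X Q -> very_generic X Q.
Proof.
move=> [b [Pb bQ]]; exists (fun k z => (b k).@[z] = 0); split=> [k|x Xx bx].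
  split; last by move=> Xb; apply: (Pb k) => z /Xb.
  by exists (fun f => f = b k) => z; split=> [bz _ ->|/(_ _ erefl)].
by apply: bQ => // i; apply/eqP/bx.
Qed.

Lemma const_in_KF f g : in_KF X F f g -> phi g != 0 /\ L (phi f / phi g).
Proof.
move=> [Pg [m [fa [fb [P [Q [fi [z0 [Xz0 fbz0 Qz0]] ev]]]]]]].
have g0 : phi g != 0 by apply/eqP => /phi0.
have fb0 i : phi (fb i) != 0 by have [h _ _] := fi i; apply/eqP => /phi0.
pose u i := phi (fa i) / phi (fb i).
have cu i : L (u i) by have [_ h _] := fi i; apply/(const_frac FX phi0 phi_frac _ (fb0 i)).
have cm (H : {mpoly K[m]}) : L (mmap (scalar_map phi) u H).
  apply: field_gen_const; apply: field_gen_sum => a _; apply: field_genM.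
    by apply/field_gen_in/(const_scalars FX); exists H@_a.
  by apply: field_gen_prod => i _; apply/field_genX/field_gen_in.
have val x (y := fun i => (fa i).@[x] / (fb i).@[x]) (H : {mpoly K[m]}) : X x ->
    (forall i, (fb i).@[x] != 0) -> has_value x (mmap (scalar_map phi) u H) H.@[y].
  by move=> Xx bx; apply: value_mmap => // i; exists (fa i), (fb i).
set P' := mmap (scalar_map phi) u P; set Q' := mmap (scalar_map phi) u Q.
have Q0 : Q' != 0.
  apply: contra_neq Qz0 => Q0; apply: (has_value_unique phi0 Xz0 (val z0 Q Xz0 fbz0)).
  by rewrite -/Q' Q0; apply: value0.
split=> //; suff -> : phi f / phi g = P' / Q'.
  apply: field_gen_const; apply: field_genM; last apply: field_genV;
    exact/field_gen_in/cm.
(* The representation is given only through values at points. A nonzero difference in [E] would be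
   nonzero at some point where all denominators are nonzero too, against those values. *)
apply: (mulIf Q0); rewrite divfK //; apply/eqP; rewrite -subr_eq0.
apply/negPn/negP => r0.
have [x Xx [[bx [c vc c0]] [gx [q vq q0]]]] := generic_point (generically_and phi0
  (generically_and phi0 (generically_denominators fb0) (generically_nonzero r0))
  (generically_and phi0 (generically_denominators (fun _ : 'I_1 => g0))
     (generically_nonzero Q0))).
have {}gx := gx ord0.
have eQ := has_value_unique phi0 Xx vq (val x Q Xx bx).
have Qx : eval_at Q fa fb x != 0 by rewrite /eval_at -eQ.
have evx := ev x Xx gx bx Qx.
have v1 : has_value x (phi f / phi g * Q') (f.@[x] / g.@[x] * eval_at Q fa fb x).
  by apply: value_mul; [exists f, g|apply: val].
have v2 : has_value x (phi f / phi g * Q') P.@[fun i => (fa i).@[x] / (fb i).@[x]].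
  rewrite evx divfK // in v1; exact: v1.
have v3 := value_add phi0 Xx vc (val x P Xx bx).
rewrite -/P' subrK in v3.
have := has_value_unique phi0 Xx v2 v3; rewrite -[LHS]add0r => /addIr e0.
by rewrite -e0 eqxx in c0.
Qed.

Lemma olist_const m (u : 'I_m -> E) : (forall i, L (u i)) ->
  forall y, y \in olist u -> L y.
Proof. by move=> Lu y /mem_olist [i ->]. Qed.

Lemma field_of_constants_trdeg : trdeg_KF_eq X F (n - p).
Proof.
have [l [Ll /(_ l (fun=> id) Ll) [t [tl it tn]]]] := generating_constants.
have np : (n - p)%N = size t by rewrite -tn addnK.
split; last first.
  move=> [ga [gb [gK /alg_indep_aindep ind]]].
  have gP i := const_in_KF (gK i).
  have /aindep_lindep it' := ind (fun i => (gP i).1).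
  have := const_lindep_size (olist_const (fun i => (gP i).2)) it'.
  by rewrite size_olist np -tn addSn ltnn.
rewrite np; have [u ut] := olist_surj t.
have Lu i : L (u i) by apply/Ll/tl; rewrite -ut; apply/mem_olist; exists i.
have iu : aindep S0 u by apply/aindep_lindep; rewrite ut.
have /choice[ab hab] i : exists ab, phi ab.2 != 0 /\ u i = phi ab.1 / phi ab.2.
  by have [a [b h]] := phi_frac (u i); exists (a, b).
pose ga i := (ab i).1; pose gb i := (ab i).2; exists ga, gb.
have gb0 i : phi (gb i) != 0 by have [] := hab i.
have uE : u = fun i => phi (ga i) / phi (gb i) by apply/funext => i; have [] := hab i.
split; last by apply/(alg_indep_aindep _ gb0); rewrite -uE.
move=> i; split; first exact: ratfun_neq0 (gb0 i).
(* [u i] is itself a first integral: if it were a scalar [c], then ['X_i - c] would be a relation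
   among the independent [u]. *)
exists 1%N, (fun=> ga i), (fun=> gb i), 'X_ord0, 1; split.
- move=> _; split; first exact: ratfun_neq0 (gb0 i).
    by apply/(const_frac FX phi0 phi_frac _ (gb0 i)); have [_ <-] := hab i.
  move=> [c /phi0/eqP]; rewrite rmorphB rmorphM subr_eq0 => /eqP gac.
  have uc : u i = phi c%:MP by rewrite uE gac mulfK.
  have /mpolyP/(_ U_(i)%MM) : 'X_i - c%:MP = 0 :> {mpoly K[size t]}.
    move/aindep_scalars: iu; apply; rewrite rmorphB /= mmapX mmap1U mmapC.
    by rewrite uc /= subrr.
  rewrite mcoeffB mcoeffX mcoeffC eqxx mnm1_eq0 mulr0 subr0 mcoeff0 => /eqP.
  by rewrite oner_eq0.
- have [z Xz bz] := generic_point (generically_denominators gb0).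
  by exists z; split=> //; rewrite /eval_at meval1 oner_eq0.
- by move=> z Xz bz _ _; rewrite /eval_at mevalXU meval1 divr1.
Qed.

Lemma fibration_by_leaves : exists (M : nat) (Y : point K M -> Prop)
    (a b : 'I_M -> {mpoly K[N]}),
  [/\ irreducible_closed Y /\ dim_eq Y (n - p),
      (forall j, rational_function X (a j) (b j)),
      (forall z y, ratmap_val X a b z y -> Y y),
      incl Y (zariski_closure (ratmap_image X a b))
    & very_generic X (fun x =>
        forall z, zariski_closure (ratmap_fiber X a b x) z <-> Vfol_pt X F x z)].
Proof.
have [l1 [Ll1 leaf]] := constants_determine_leaf FX phi0 phi_frac.
have [l2 [Ll2 gen]] := generating_constants.
pose l := l1 ++ l2; have Ll y : y \in l -> L y.
  by rewrite mem_cat => /orP [/Ll1|/Ll2].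
have [|t [tl it tn]] := gen l _ Ll; first by move=> y yl; rewrite mem_cat yl orbT.
have np : (n - p)%N = size t by rewrite -tn addnK.
pose M := size l; pose f (j : 'I_M) := nth 0 l j.
have Lf j : L (f j) by apply/Ll/mem_nth.
have lf y : y \in l -> exists j, f j = y.
  move=> yl; have yi : (index y l < M)%N by rewrite index_mem.
  by exists (Ordinal yi); rewrite /f nth_index.
have /choice[ab hab] i : exists ab, phi ab.2 != 0 /\ f i = phi ab.1 / phi ab.2.
  by have [a [b h]] := phi_frac (f i); exists (a, b).
pose a i := (ab i).1; pose b i := (ab i).2.
have b0 i : phi (b i) != 0 by have [] := hab i.
have fE i : f i = phi (a i) / phi (b i) by have [] := hab i.
(* The kernel of [psi] consists of the relations over [K] between the components [f], so its zero
   set is the closure of the image; it is prime because [E] is a field. *)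
pose psi : {rmorphism {mpoly K[M]} -> E} :=
  [the {rmorphism _ -> _} of mmap (scalar_map phi) f].
pose Q H := psi H = 0.
have pQ : is_prime_ideal Q.
  split; first split; rewrite /Q ?rmorph0 //.
  - by move=> g h g0 h0; rewrite rmorphD g0 h0 addr0.
  - by move=> g h h0; rewrite rmorphM h0 mulr0.
  - by rewrite rmorph1; apply/eqP; rewrite oner_eq0.
  - by move=> g h /eqP; rewrite rmorphM mulf_eq0 => /orP [] /eqP; [left|right].
have iQ : is_ideal Q by case: pQ.
have SE : scalars psi = S0.
  by apply/funext => x; apply/propext; split=> [] [c ->]; exists c; rewrite /psi /= mmapC.
have chainY k : has_chain (zero_set Q) k <->
    exists s : 'I_k -> 'I_M, aindep S0 (fun i => f (s i)).
  have psiX k' (s : 'I_k' -> 'I_M) : indep_mod Q s <-> aindep S0 (fun i => f (s i)).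
    rewrite (indep_mod_aindep (phi := psi)) // SE.
    by rewrite (_ : (fun i => psi _) = (fun i => f (s i))) //; apply/funext => i;
      rewrite /psi /= mmapX mmap1U.
  rewrite (has_chain_indep Kunc k iQ).
  by split=> [] [s] /psiX; exists s.
have fval z i : X z -> (b i).@[z] != 0 -> has_value z (f i) ((a i).@[z] / (b i).@[z]).
  by move=> Xz bz; rewrite fE; exists (a i), (b i).
exists M, (zero_set Q), a, b; split.
- split; first exact: zero_set_irreducible.
  split.
    apply/chainY; rewrite np; have [u ut] := olist_surj t.
    have /choice[s hs] i : exists j, f j = u i.
      by apply/lf/tl; rewrite -ut; apply/mem_olist; exists i.
    exists s; rewrite (_ : (fun i => _) = u); last exact/funext.
    by apply/aindep_lindep; rewrite ut.
  move=> /chainY [s /aindep_lindep is_].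
  have := const_lindep_size (olist_const (fun i => Lf (s i))) is_.
  by rewrite size_olist np -tn addSn ltnn.
- by move=> j; apply: ratfun_neq0 (b0 j).
- move=> z y [Xz zy] H HQ.
  have vy i : has_value z (f i) (y i) by rewrite fE; apply/(ratval_value _ _ Xz (b0 i)).
  apply: (has_value_unique phi0 Xz (value_mmap H Xz vy)).
  by rewrite -[mmap _ _ _]/(psi H) HQ; apply: value0.
(* A polynomial nonzero at [f] takes a nonzero value at the image of a generic point. *)
- move=> y Qy H vH; apply: Qy; apply/eqP/negPn/negP => H0.
  have [x Xx [bx [c vc c0]]] := generic_point
    (generically_and phi0 (generically_denominators b0) (generically_nonzero H0)).
  pose yx i := (a i).@[x] / (b i).@[x].
  have vyx i : has_value x (f i) (yx i) by apply: fval.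
  have Hyx : H.@[yx] = 0.
    apply: vH; exists x; split=> // j; apply/(ratval_value _ _ Xx (b0 j)).
    by rewrite -fE; apply: vyx.
  have := has_value_unique phi0 Xx vc (value_mmap H Xx vyx).
  by rewrite Hyx => c00; rewrite c00 eqxx in c0.
apply: very_generically_very_generic.
have := very_generically_and leaf (very_generically_generic (generically_denominators b0)).
apply: very_generically_mono => x Xx [leafx bx] z.
rewrite (VfolE _ Xx); split=> [cz|wz].
  (* Points of the fibre share with [x] the values of all components, so they lie on the leaf, which
     is closed. *)
  move=> g wg; apply: cz => z' [y [[_ xy] [Xz' z'y]]].
  apply: (leafx z' Xz') wg => e el1.
  have [j <-] : exists j, f j = e by apply: lf; rewrite mem_cat el1.
  have vx : has_value x (f j) (y j) by rewrite fE; apply/(ratval_value _ _ Xx (b0 j)).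
  have vz : has_value z' (f j) (y j) by rewrite fE; apply/(ratval_value _ _ Xz' (b0 j)).
  split; [by exists (y j)|by exists (y j)|].
  by rewrite (value_spec phi0 Xx vx) (value_spec phi0 Xz' vz).
(* Off the zeros of [B] the leaf lies in the fibre, so [g * B] vanishes on the whole leaf and some
   power of it is in I(F,x); there [B ^+ k] cancels, since [B] does not vanish at [x]. *)
move=> g vg; pose B := \prod_j b j.
have Bx : B.@[x] != 0 by rewrite /B rmorph_prod; apply/prodf_neq0 => j _; exact: bx.
have [k gBk] : exists k, wideal F x ((g * B) ^+ k).
  apply: (nullstellensatz Kunc (wideal_ideal FX x)) => z' wz'.
  rewrite mevalM; have [Bz'|Bz'] := eqVneq B.@[z'] 0; first by rewrite Bz' mulr0.
  have bz' j : (b j).@[z'] != 0.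
    by apply: contra_neq Bz' => bj; rewrite /B rmorph_prod /= (bigD1 j) //= bj mul0r.
  have Xz' := leaf_sub_X Xx wz'.
  rewrite vg ?mul0r //; pose y j := (a j).@[x] / (b j).@[x]; exists y; split; split=> // j.
    by apply/(ratval_value _ _ Xx (b0 j)); rewrite -fE; apply: fval.
  apply/(ratval_value _ _ Xz' (b0 j)); rewrite -fE.
  have : (a j - y j *: b j).@[z'] = 0.
    by apply/wz'/wideal_const => //; rewrite -fE.
  rewrite mevalB mevalZ => /eqP; rewrite subr_eq0 => /eqP ay.
  by have := fval z' j Xz' (bz' j); rewrite ay mulfK.
have wgk : wideal F x (g ^+ k).
  apply: (wideal_cancel FX (g := B ^+ k)); last by rewrite -exprMn.
  by rewrite rmorphXn expf_neq0.
have := wz _ wgk; rewrite rmorphXn => /eqP; rewrite expf_eq0 => /andP [_ /eqP].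
by [].
Qed.

End Main.

Theorem theorem2 (R : realType) (N n : nat) (X : point R[i] N -> Prop)
    (F : ({mpoly R[i][N]} -> {mpoly R[i][N]}) -> Prop) (p : nat) :
  irreducible_closed X ->
  dim_eq X n ->
  foliation X F ->
  (* p = max_{x in X} dim V(F,x) *)
  (exists x, X x /\ dim_eq (Vfol_pt X F x) p) ->
  (forall x d, X x -> dim_eq (Vfol_pt X F x) d -> (d <= p)%N) ->
  (exists (M : nat) (Y : point R[i] M -> Prop) (a b : 'I_M -> {mpoly R[i][N]}),
     [/\ irreducible_closed Y /\ dim_eq Y (n - p),
         (forall j, rational_function X (a j) (b j)),
         (forall z y, ratmap_val X a b z y -> Y y),
         incl Y (zariski_closure (ratmap_image X a b))
       & very_generic X (fun x =>
           forall z, zariski_closure (ratmap_fiber X a b x) z <-> Vfol_pt X F x z)])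
  /\ trdeg_KF_eq X F (n - p).
Proof.
move=> Xirr Xdim [FX _] p_att p_max; have Kunc := @complex_uncountable R.
have [E [phi [phi0 phi_frac]]] := function_field (irreducible_prime Xirr).
split.
  exact: (fibration_by_leaves Kunc Xirr Xdim FX p_att p_max phi0 phi_frac).
exact: (field_of_constants_trdeg Kunc Xirr Xdim FX p_att p_max phi0 phi_frac).
Qed.
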